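(* Let $\Phi\in\mathcal P$. (1) Let $k=(k_1,k_2,k_3)$ with $k_i>0$. If $\tilde\alpha$ is the $k$-weighted $l^1$-energy minimizing map in $\mathcal F_\Psi(\Phi)$, then it is the $c$-weighted $l^2$-energy minimizing map in $\mathcal F_\Psi(\Phi)$ with $$c=\left(\frac{E(\tilde\alpha_1)}{k_1\sum_{j=1}^3(E(\tilde\alpha_j)/k_j)},\ \frac{E(\tilde\alpha_2)}{k_2\sum_{j=1}^3(E(\tilde\alpha_j)/k_j)},\ \frac{E(\tilde\alpha_3)}{k_3\sum_{j=1}^3(E(\tilde\alpha_j)/k_j)}\right).$$ (2) Let $c=(c_1,c_2,c_3)\in\mathcal C$. If $\tilde\alpha$ is the $c$-weighted $l^2$-energy minimizing map in $\mathcal F_\Psi(\Phi)$, then $\tilde\alpha$ is the $k$-weighted $l^1$-energy minimizing map in $\mathcal F_\Psi(\Phi)$ with $$k=\left(\frac{E(\tilde\alpha_1)}{x_1},\ \frac{E(\tilde\alpha_2)}{x_2},\ \frac{E(\tilde\alpha_3)}{x_3}\right),$$ where $x=(x_1,x_2,x_3)$ is the solution to the linear system $(C-I)x=0$, $C$ being the $3\times 3$ matrix with all columns equal to $c$ and $I$ the identity matrix.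
   Context: Let $\triangle\subset\mathbf R^2$ be the (open) unit disk and $\triangle_1,\triangle_2,\triangle_3$ three copies of it. Put $B_i=\partial\triangle_i\cap\{y\ge 0\}$ and $A_i=\partial\triangle_i\cap\{y\le 0\}$. Gluing maps: $\mathcal P$ is the set of triples $\Phi=(\phi_1,\phi_2,\phi_3)$ of homeomorphisms $\phi_i:\partial\triangle_i\to\partial\triangle_i$ with $\phi_i(-1,0)=(-1,0)$, $\phi_i(1,0)=(1,0)$, $\phi_i(0,1)=(0,1)$. Boundary data: $\Gamma$ is a graph embedded in $\mathbf R^n$ consisting of three arcs $\Gamma_1,\Gamma_2,\Gamma_3$ sharing common end points $q_-$ and $q_+$. A fixed uniform parameterization $\Psi=(\psi_1,\psi_2,\psi_3)$ of $\Gamma$ is given: $\psi_i:B_i\to\mathbf R^n$ is a constant speed parameterization of $\Gamma_i$ with $\psi_i(-1,0)=q_-$ and $\psi_i(1,0)=q_+$. Admissible maps: $\mathcal F_\Psi(\Phi)$ is the set of $\alpha=(\alpha_1,\alpha_2,\alpha_3)$ with $\alpha_i:\overline{\triangle_i}\to\mathbf R^n$, $\alpha_i\in W^{1,2}(\triangle_i)\cap C^0(\overline{\triangle_i})$, satisfying the matching condition $\alpha_i\circ\phi_i|_{A_i}=\alpha_j\circ\phi_j|_{A_j}$ for all $i,j$ (the $A_i$ being identified as copies of the same arc) and the boundary condition $\alpha_i\circ\phi_i|_{B_i}=\psi_i$ for all $i$. Energies: $E(\alpha_i)=\int_{\triangle_i}|\nabla\alpha_i|^2\,dx\,dy$ is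 the Dirichlet energy. For $k=(k_1,k_2,k_3)$ with $k_i>0$, the $k$-weighted $l^1$-energy is $E^k(\alpha)=\sum_{i=1}^3k_iE(\alpha_i)$. Let $\mathcal C=\{c=(c_1,c_2,c_3)\in\mathbf R^3: c_1+c_2+c_3=1,\ c_i\ge 0 \text{ for } i=1,2,3\}$. For $c\in\mathcal C$, $\alpha$ is compatible with $c$ if $E(\alpha_i)=0$ whenever $c_i=0$; the $c$-weighted $l^2$-energy is $E_c(\alpha)=\left(\sum_{i:\,c_i\ne 0}\frac1{c_i}E(\alpha_i)^2\right)^{1/2}$ if $\alpha$ is compatible with $c$ and $E_c(\alpha)=\infty$ otherwise. $\alpha\in\mathcal F_\Psi(\Phi)$ is a $k$-weighted $l^1$-energy (resp. $c$-weighted $l^2$-energy) minimizing map if it minimizes $E^k$ (resp. $E_c$) over $\mathcal F_\Psi(\Phi)$. *)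

(* Defs.v *)
From HB Require Import structures.
From mathcomp Require Import all_boot all_order all_algebra.
From mathcomp Require Import all_classical all_reals all_analysis.
Set Implicit Arguments.
Unset Strict Implicit.
Unset Printing Implicit Defensive.
Import Order.TTheory GRing.Theory Num.Theory.
Import numFieldNormedType.Exports.
Local Open Scope classical_set_scope.
Local Open Scope ring_scope.

Section Disk.
Context {R : realType}.

Definition disk : set (R * R) := [set p | p.1 ^+ 2 + p.2 ^+ 2 < 1].
Definition closed_disk : set (R * R) := [set p | p.1 ^+ 2 + p.2 ^+ 2 <= 1].
Definition circle : set (R * R) := [set p | p.1 ^+ 2 + p.2 ^+ 2 = 1].

(* The arcs B_i and A_i. The three disks are copies of a single one, so the
   index i only appears on the maps. *)
Definition upper_arc : set (R * R) := circle `&` [set p | 0 <= p.2].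
Definition lower_arc : set (R * R) := circle `&` [set p | p.2 <= 0].

Definition circle_point (theta : R) : R * R := (cos theta, sin theta).

End Disk.

Section Gluing.
Context {R : realType}.

Definition homeomorphism_on (X Y : topologicalType) (A : set X) (B : set Y)
    (f : X -> Y) : Prop :=
  {within A, continuous f} /\
  exists g : Y -> X, [/\ {within B, continuous g},
    forall x, A x -> B (f x), forall y, B y -> A (g y),
    forall x, A x -> g (f x) = x & forall y, B y -> f (g y) = y].

Definition gluing_maps (Phi : 'I_3 -> R * R -> R * R) : Prop :=
  forall i, [/\ homeomorphism_on circle circle (Phi i),
    Phi i (-1, 0) = (-1, 0), Phi i (1, 0) = (1, 0) & Phi i (0, 1) = (0, 1)].

End Gluing.

Section BoundaryData.
Context {R : realType} {n : nat}.

Definition is_arc (A : set 'rV[R]_n) (q q' : 'rV[R]_n) : Prop :=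
  exists gamma : R -> 'rV[R]_n,
    [/\ homeomorphism_on (`[0, 1] : set R) A gamma, gamma 0 = q & gamma 1 = q'].

Definition embedded_graph (Gamma : 'I_3 -> set 'rV[R]_n) (qm qp : 'rV[R]_n) :
    Prop :=
  (forall i, is_arc (Gamma i) qm qp) /\
  (forall i j, i != j -> Gamma i `&` Gamma j = [set qm; qp]).

(* The norm of the library on 'rV[R]_n is the sup norm, which would give the
   wrong notion of length. *)
Definition euclidean_norm (v : 'rV[R]_n) : R :=
  Num.sqrt (\sum_(j < n) v 0 j ^+ 2).

(* Vector-valued analogue of [variation] and [total_variation] *)
Definition polygonal_length (a b : R) (gamma : R -> 'rV[R]_n) (s : seq R) : R :=
  let F := gamma \o nth b (a :: s) in
  \sum_(0 <= k < size s) euclidean_norm (F k.+1 - F k).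

Definition curve_length (a b : R) (gamma : R -> 'rV[R]_n) : \bar R :=
  ereal_sup [set (polygonal_length a b gamma s)%:E | s in itv_partition a b].

(* Constant speed in the metric sense, with respect to the arc length theta of
   the upper half circle; no differentiability of the arc is assumed. *)
Definition constant_speed (psi : R * R -> 'rV[R]_n) : Prop :=
  exists v : R, forall s t, 0 <= s -> s <= t -> t <= pi ->
    curve_length s t (psi \o circle_point) = (v * (t - s))%:E.

Definition uniform_parameterization (Gamma : 'I_3 -> set 'rV[R]_n)
    (qm qp : 'rV[R]_n) (Psi : 'I_3 -> R * R -> 'rV[R]_n) : Prop :=
  forall i, [/\ homeomorphism_on upper_arc (Gamma i) (Psi i),
    constant_speed (Psi i), Psi i (-1, 0) = qm & Psi i (1, 0) = qp].

End BoundaryData.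

Section Sobolev.
Context {R : realType}.

Local Notation area := (@lebesgue_measure R \x @lebesgue_measure R)%E.

Definition e1 : R * R := (1, 0).
Definition e2 : R * R := (0, 1).

Definition L2_disk (u : R * R -> R) : Prop :=
  measurable_fun disk u /\ area.-integrable disk (fun p => (u p ^+ 2)%:E).

(* C^1 functions with compact support in the disk. For first order weak
   derivatives these give the same notion as C^oo test functions (by
   mollification). *)
Definition test_function (f : R * R -> R) : Prop :=
  [/\ forall p, derivable f p e1 /\ derivable f p e2,
      continuous ('D_e1 f), continuous ('D_e2 f) &
      exists2 K, compact K /\ K `<=` disk & forall p, ~ K p -> f p = 0].

(* g is a square integrable weak derivative of u in the direction e *)
Definition weak_derivative (e : R * R) (u g : R * R -> R) : Prop :=
  L2_disk g /\ forall f, test_function f ->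
    \int[area]_(p in disk) (u p * 'D_e f p) =
    - \int[area]_(p in disk) (g p * f p).

Definition W12 (u : R * R -> R) : Prop :=
  [/\ L2_disk u, exists g, weak_derivative e1 u g &
      exists g, weak_derivative e2 u g].

(* A representative, unique up to null sets; junk if u has no square
   integrable weak derivative in the direction e. *)
Definition weak_partial (e : R * R) (u : R * R -> R) : R * R -> R :=
  xget (fun=> 0) [set g | weak_derivative e u g].

Definition coordinate {n} (a : R * R -> 'rV[R]_n) (j : 'I_n) : R * R -> R :=
  fun p => a p 0 j.

Definition energy {n} (a : R * R -> 'rV[R]_n) : R :=
  \int[area]_(p in disk)
    (\sum_(j < n) (weak_partial e1 (coordinate a j) p ^+ 2 +
                   weak_partial e2 (coordinate a j) p ^+ 2)).

End Sobolev.

Section Admissible.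
Context {R : realType} {n : nat}.
Variables (Psi : 'I_3 -> R * R -> 'rV[R]_n) (Phi : 'I_3 -> R * R -> R * R).

(* Maps are total functions on the plane; their values outside of the closed
   disk are irrelevant. *)
Definition admissible : set ('I_3 -> R * R -> 'rV[R]_n) :=
  [set alpha |
    [/\ forall i j, W12 (coordinate (alpha i) j),
        forall i, {within closed_disk, continuous (alpha i)},
        forall i j p, lower_arc p -> alpha i (Phi i p) = alpha j (Phi j p) &
        forall i p, upper_arc p -> alpha i (Phi i p) = Psi i p]].

Definition energy_l1 (k : 'I_3 -> R) (alpha : 'I_3 -> R * R -> 'rV[R]_n) : R :=
  \sum_(i < 3) k i * energy (alpha i).

Definition simplex : set ('I_3 -> R) :=
  [set c | \sum_(i < 3) c i = 1 /\ forall i, 0 <= c i].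

Definition compatible (c : 'I_3 -> R) (alpha : 'I_3 -> R * R -> 'rV[R]_n) :
    bool :=
  [forall i, (c i == 0) ==> (energy (alpha i) == 0)].

Definition energy_l2 (c : 'I_3 -> R) (alpha : 'I_3 -> R * R -> 'rV[R]_n) :
    \bar R :=
  if compatible c alpha then
    (Num.sqrt (\sum_(i < 3 | c i != 0) (c i)^-1 * energy (alpha i) ^+ 2))%:E
  else +oo%E.

Definition l1_minimizing (k : 'I_3 -> R) (alpha : 'I_3 -> R * R -> 'rV[R]_n) :
    Prop :=
  admissible alpha /\
  forall beta, admissible beta -> energy_l1 k alpha <= energy_l1 k beta.

Definition l2_minimizing (c : 'I_3 -> R) (alpha : 'I_3 -> R * R -> 'rV[R]_n) :
    Prop :=
  admissible alpha /\
  forall beta, admissible beta -> (energy_l2 c alpha <= energy_l2 c beta)%E.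

End Admissible.

(* Main.v *)
Require Import Defs.
From mathcomp Require Import all_boot all_order all_algebra.
From mathcomp Require Import all_classical all_reals all_analysis.
From mathcomp Require Import measurable_realfun ring lra.
Set Implicit Arguments.
Unset Strict Implicit.
Unset Printing Implicit Defensive.
Import Order.TTheory GRing.Theory Num.Theory.
Import numFieldNormedType.Exports.
Local Open Scope classical_set_scope.
Local Open Scope ring_scope.

(* Write E_i for the energies of the minimizer and F_i for those of a
   competitor. For (1), c_i = E_i / (k_i S) gives
   sum E_i^2 / c_i = S sum k_i E_i, and F^2 >= E^2 + 2 E (F - E) turns
   sum k_i E_i <= sum k_i F_i into the l^2 inequality. For (2), the admissible
   set and the Dirichlet energy are convex, so the first variation of the l^2
   energy along alpha + t (beta - alpha) is nonnegative at t = 0; this is the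
   l^1 inequality, because x_i = c_i (x_1 + x_2 + x_3).

   Both parts need E_i > 0: an admissible map of zero energy has zero weak
   gradient, so it is constant, while psi_i separates (-1, 0) from (1, 0).
   Convexity needs weak derivatives to be unique up to null sets, which is the
   fundamental lemma of the calculus of variations on the disk. *)

(** Neither the fundamental lemma nor the constancy of maps with zero weak gradient goes through
    mollification. Since test functions only have to be C^1, explicit ones suffice, built from the
    squared positive part [posq] and, for the cutoffs, [expR]. The cutoffs converge to indicators of
    quadrants, so a function orthogonal to all test functions has zero integral over the part of the
    disk in each quadrant; quadrants form a pi-system that generates the measurable sets. For
    constancy, a test function whose derivative is one bump minus a translate of it compares values
    at two points of a horizontal or vertical segment; continuity, which is part of admissibility,
    gives these point values a meaning. *)

Section PlaneMeasure.
Context {R : realType}.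
Local Notation area := (@lebesgue_measure R \x @lebesgue_measure R)%E.

(** Measurability on the plane is that of the product sigma-algebra, so an open set has to be
    exhausted by countably many boxes with rational corners. *)
Lemma open_measurable_plane (O : set (R * R)) : open O -> measurable O.
Proof.
move=> oO.
pose B (k : rat * rat * (rat * rat)) : set (R * R) :=
  `]ratr k.1.1, ratr k.1.2[ `*` `]ratr k.2.1, ratr k.2.2[.
(* A box that is not contained in O contributes the empty set, which keeps the union indexed by all
   of [nat]. *)
pose F (i : nat) : set (R * R) :=
  if unpickle i is Some k then [set p | B k p /\ B k `<=` O] else set0.
have -> : O = \bigcup_i F i.
  apply/seteqP; split => [[x y] Oxy|p [i _]]; last first.
    by rewrite /F; case: unpickle => // k [Bkp]; exact.
  have /nbhs_ballP[e /= e0 eO] := open_nbhs_nbhs (conj oO Oxy).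
  have [|a] := @rat_in_itvoo R (x - e) x; first by rewrite ltrBlDr ltrDl.
  have [|b] := @rat_in_itvoo R x (x + e); first by rewrite ltrDl.
  have [|c] := @rat_in_itvoo R (y - e) y; first by rewrite ltrBlDr ltrDl.
  have [|d] := @rat_in_itvoo R y (y + e); first by rewrite ltrDl.
  rewrite !in_itv/= => /andP[yd de] /andP[ec cy] /andP[xb be] /andP[ea ax].
  exists (pickle ((a, b), (c, d))); [by []|rewrite /F pickleK; split].
    by rewrite /B /= !in_itv/= yd cy xb ax.
  move=> [s t] []/=; rewrite !in_itv/= => /andP[as_ sb] /andP[ct td].
  apply: eO; split; rewrite ball_itv/= in_itv/= .
    by rewrite (lt_trans ea)// (lt_trans sb).
  by rewrite (lt_trans ec)// (lt_trans td).
apply: bigcupT_measurable => i; rewrite /F; case: unpickle => // k.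
have [BkO|BkO] := pselect (B k `<=` O).
  have -> : [set p | B k p /\ B k `<=` O] = B k by apply/seteqP; split => // p [].
  by apply: measurableX; exact: measurable_itv.
by have -> : [set p | B k p /\ B k `<=` O] = set0 by apply/seteqP; split => // p [].
Qed.

Lemma continuous_measurable_plane (f : R * R -> R) :
  continuous f -> measurable_fun setT f.
Proof.
move=> /continuousP cf.
apply: (measurability _ (RGenOpens.measurableE R)) => //.
move=> _ [_ [a [b ->]] <-]; rewrite setTI; apply: open_measurable_plane.
by apply: cf; exact: interval_open.
Qed.

Lemma continuous_sqr_norm : continuous (fun p : R * R => p.1 ^+ 2 + p.2 ^+ 2).
Proof.
move=> p; apply: (@continuousD _ _ _ (fun p : R * R => p.1 ^+ 2) (fun p => p.2 ^+ 2)).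
  apply: (@continuous_comp _ _ _ fst (fun x : R => x ^+ 2)).
    exact: cvg_fst.
  exact: exprn_continuous.
apply: (@continuous_comp _ _ _ snd (fun x : R => x ^+ 2)).
  exact: cvg_snd.
exact: exprn_continuous.
Qed.

Lemma open_disk : open (@disk R).
Proof.
have /continuousP/(_ _ (@open_lt R 1)) := continuous_sqr_norm.
by congr open; apply/seteqP; split.
Qed.

Lemma measurable_disk : measurable (@disk R).
Proof. exact: open_measurable_plane open_disk. Qed.

Lemma disk_bound (p : R * R) : disk p -> `|p.1| < 1 /\ `|p.2| < 1.
Proof.
case: p => x y; rewrite /disk/= => h; split; rewrite ltr_norml; nra.
Qed.

Lemma area_disk_lty : (area (@disk R) < +oo)%E.
Proof.
apply: (@le_lt_trans _ _ (area (`[-1, 1] `*` `[-1, 1]))).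
  apply: le_measure; rewrite ?inE.
  - exact: measurable_disk.
  - by apply: measurableX; exact: measurable_itv.
  move=> p /disk_bound[]; rewrite !ltr_norml => /andP[a b] /andP[c d].
  by split; rewrite /= in_itv/= !ltW.
rewrite product_measure1E; [|exact: measurable_itv..].
have h : (@lebesgue_measure R `[(-1)%R, 1%R] < +oo)%E.
  by rewrite lebesgue_measure_itv/=; case: ifPn => // _; rewrite -EFinD ltry.
by rewrite lte_mul_pinfty// ge0_fin_numE.
Qed.

(** The disk has finite area and |u| <= 1 + u^2. *)
Lemma L2_disk_integrable (u : R * R -> R) :
  L2_disk u -> area.-integrable disk (EFin \o u).
Proof.
move=> [mu iu2].
have i1 : area.-integrable disk (fun p : R * R => (1 + u p ^+ 2)%:E).
  have -> : (fun p : R * R => (1 + u p ^+ 2)%:E) =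
      (fun=> 1%E) \+ (fun p => (u p ^+ 2)%:E) by apply/funext => p.
  apply: integrableD => //; first exact: measurable_disk.
  apply: (@measurable_bounded_integrable _ _ _ _ (cst 1)) => //.
  - exact: measurable_disk.
  - exact: area_disk_lty.
  - by exists 1; split => // N N1 p _ /=; rewrite normr1 ltW.
apply: le_integrable i1 => //; first exact: measurable_disk.
  exact/measurable_EFinP.
move=> p _; rewrite /= lee_fin.
rewrite [leRHS]ger0_norm ?addr_ge0 ?sqr_ge0//.
have := sqr_ge0 (`|u p| - 1); rewrite -(real_normK (num_real (u p))).
move: `|u p| => t; nra.
Qed.

Lemma integrableMr_bounded (u b : R * R -> R) (M : R) :
  area.-integrable disk (EFin \o u) -> measurable_fun setT b ->
  (forall p, `|b p| <= M) ->
  area.-integrable disk (EFin \o (fun p => u p * b p)).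
Proof.
move=> iu mb bM.
have -> : EFin \o (fun p => u p * b p) = ((EFin \o u) \* (EFin \o b))%E.
  by apply/funext => p /=; rewrite EFinM.
apply: integrableMl => //.
- exact: measurable_disk.
- exact: measurable_funS mb.
exists M; split; first exact: num_real.
by move=> N MN p _ /=; rewrite (le_trans (bM p))// ltW.
Qed.

End PlaneMeasure.

(** * Directional derivatives in the plane, reduced to one variable *)

Section DirectionalDerivatives.
Context {R : realType}.
Implicit Types (f : R * R -> R) (p v : R * R).

(** Test functions are only known to have directional derivatives; restriction to the line through p
    makes the one-variable chain rule available. *)
Lemma is_derive_lineE f p v (l : R) :
  is_derive p v f l <-> is_derive (0 : R) 1 (fun h => f (h *: v + p)) l.
Proof.
have E : (fun h => h^-1 *: ((f \o shift p) (h *: v) - f p)) =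
    (fun h => h^-1 *: (((fun h : R => f (h *: v + p)) \o shift 0) (h *: 1) -
       f (0 *: v + p))).
  by apply/funext => h /=; rewrite addr0 scale0r add0r [_%:A]mulr1.
split=> -[h1 h2]; apply: DeriveDef.
- by rewrite /derivable -E.
- by rewrite -h2 /derive -E.
- by rewrite /derivable E.
- by rewrite -h2 /derive E.
Qed.

Lemma is_derive_comp f p v (g : R -> R) (df dg : R) :
  is_derive p v f df -> is_derive (f p) 1 g dg ->
  is_derive p v (g \o f) (dg * df).
Proof.
move=> /is_derive_lineE hf hg; apply/is_derive_lineE.
apply: (@is_derive1_comp _ g (fun h => f (h *: v + p))).
by rewrite scale0r add0r.
Qed.

Lemma is_derive_row f (x y l : R) :
  is_derive (x, y) e1 f l -> is_derive x 1 (fun s => f (s, y)) l.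
Proof.
have E : (fun h => h^-1 *: ((f \o shift (x, y)) (h *: e1) - f (x, y))) =
    (fun h => h^-1 *: (((fun s => f (s, y)) \o shift x) (h *: 1) - f (x, y))).
  apply/funext => h /=; congr (_ *: (f _ - _)).
  by rewrite /e1; congr pair => /=; rewrite scaler0 add0r.
move=> [h1 h2]; apply: DeriveDef.
- by rewrite /derivable -E.
- by rewrite -h2 /derive -E.
Qed.

Lemma is_derive_column f (x y l : R) :
  is_derive (x, y) e2 f l -> is_derive y 1 (fun s => f (x, s)) l.
Proof.
have E : (fun h => h^-1 *: ((f \o shift (x, y)) (h *: e2) - f (x, y))) =
    (fun h => h^-1 *: (((fun s => f (x, s)) \o shift y) (h *: 1) - f (x, y))).
  apply/funext => h /=; congr (_ *: (f _ - _)).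
  by rewrite /e2; congr pair => /=; rewrite scaler0 add0r.
move=> [h1 h2]; apply: DeriveDef.
- by rewrite /derivable -E.
- by rewrite -h2 /derive -E.
Qed.

Lemma is_derive_continuous (f df : R -> R) :
  (forall x : R, is_derive x 1 f (df x)) -> continuous f.
Proof.
move=> h x; apply/differentiable_continuous/derivable1_diffP.
by case: (h x).
Qed.

Lemma is_derive_lipschitz (f df : R -> R) (M : R) :
  (forall x : R, is_derive x 1 f (df x)) -> (forall x, `|df x| <= M) ->
  forall x y, `|f x - f y| <= M * `|x - y|.
Proof.
move=> fdf dfM.
suff H x y : x <= y -> `|f y - f x| <= M * `|y - x|.
  move=> x y; have [xy|/ltW yx] := leP x y; last exact: H.
  by rewrite distrC (distrC x); exact: H.
move=> xy; have [|c _ ->] := MVT_segment xy (fun x _ => fdf x).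
  exact: continuous_subspaceT (is_derive_continuous fdf).
by rewrite normrM ler_wpM2r.
Qed.

End DirectionalDerivatives.

(** * Boundedness and continuity of test functions, and integrability against them *)

Section TestFunctions.
Context {R : realType}.
Local Notation area := (@lebesgue_measure R \x @lebesgue_measure R)%E.
Implicit Types f : R * R -> R.

Lemma bounded_compact_support (f : R * R -> R) (K : set (R * R)) :
  compact K -> continuous f -> (forall p, ~ K p -> f p = 0) ->
  exists M, forall p, `|f p| <= M.
Proof.
move=> cK cf f0.
have [M [_ MP]] := compact_bounded (continuous_compact (continuous_subspaceT cf) cK).
exists (`|M| + 1) => p; have [Kp|/f0 ->] := pselect (K p).
  by apply: (MP (`|M| + 1)); [rewrite ltr_pwDr// ler_norm|exists p].
by rewrite normr0 addr_ge0.
Qed.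

Lemma derive_eq0_outside f (K : set (R * R)) v p :
  compact K -> (forall p, ~ K p -> f p = 0) -> ~ K p -> 'D_v f p = 0.
Proof.
move=> cK f0 Kp.
have oK : open (~` K) by apply: closed_openC; apply: compact_closed.
rewrite (@near_eq_derive _ _ _ f (cst 0)); first exact: derive_cst.
by apply: filterS (open_nbhs_nbhs (conj oK Kp)) => q /f0.
Qed.

Lemma test_function_derive_bounded f : test_function f ->
  exists M, forall p, `|'D_e1 f p| <= M /\ `|'D_e2 f p| <= M.
Proof.
move=> [_ c1 c2 [K [cK _] f0]].
have [M1 h1] := bounded_compact_support cK c1 (fun p => @derive_eq0_outside _ _ _ p cK f0).
have [M2 h2] := bounded_compact_support cK c2 (fun p => @derive_eq0_outside _ _ _ p cK f0).
exists (Num.max M1 M2) => p; split.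
  by rewrite (le_trans (h1 p))// le_max lexx.
by rewrite (le_trans (h2 p))// le_max lexx orbT.
Qed.

Lemma test_function_is_derive f : test_function f ->
  forall p, is_derive p e1 f ('D_e1 f p) /\ is_derive p e2 f ('D_e2 f p).
Proof. by move=> [df _ _ _] p; have [? ?] := df p; split; exact: derivableP. Qed.

(** [test_function] asks only the partial derivatives to be continuous. Having compact support, they
    are bounded, so f is Lipschitz along horizontal and vertical lines, and two points are joined by
    one segment of each kind. *)
Lemma test_function_continuous f : test_function f -> continuous f.
Proof.
move=> tf; have [M MP] := test_function_derive_bounded tf.
have df := test_function_is_derive tf.
have M0 : 0 <= M by have [+ _] := MP 0; exact: le_trans.
have L (x y x' y' : R) : `|f (x, y) - f (x', y')| <= M * (`|x - x'| + `|y - y'|).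
  rewrite -(subrKA (f (x', y))) mulrDr (le_trans (ler_normD _ _))// lerD//.
    apply: (@is_derive_lipschitz _ (fun s => f (s, y)) (fun s => 'D_e1 f (s, y))).
      by move=> s; apply: is_derive_row; case: (df (s, y)).
    by move=> s; have [h _] := MP (s, y); exact: h.
  apply: (@is_derive_lipschitz _ (fun s => f (x', s)) (fun s => 'D_e2 f (x', s))).
    by move=> s; apply: is_derive_column; case: (df (x', s)).
  by move=> s; have [_ h] := MP (x', s); exact: h.
move=> [x y]; apply/cvgrPdist_lt => e e0.
(* The 2 accounts for the two segments; [M + 1] keeps the denominator positive when M = 0. *)
pose d := e / (2 * (M + 1)).
have d0 : 0 < d by rewrite divr_gt0// mulr_gt0// ltr_wpDl.
have /= := nbhsx_ballx (x, y) d d0; apply: filterS => -[x' y'] [/=].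
rewrite -!ball_normE/= => xx' yy'.
apply: (le_lt_trans (L _ _ _ _)).
have : e = (M + 1) * (d + d) by rewrite /d; field; lra.
nra.
Qed.

Lemma test_function_bounded f : test_function f -> exists M, forall p, `|f p| <= M.
Proof.
move=> tf; have cf := test_function_continuous tf.
by case: tf => _ _ _ [K [cK _] f0]; exact: bounded_compact_support cK cf f0.
Qed.

Lemma integrable_test f (u : R * R -> R) :
  test_function f -> area.-integrable disk (EFin \o u) ->
  area.-integrable disk (EFin \o (fun p => u p * f p)).
Proof.
move=> tf iu; have [M fM] := test_function_bounded tf.
apply: integrableMr_bounded iu _ fM.
exact: continuous_measurable_plane (test_function_continuous tf).
Qed.

Lemma integrable_test_derive f (u : R * R -> R) e :
  (e = e1 \/ e = e2) -> test_function f -> area.-integrable disk (EFin \o u) ->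
  area.-integrable disk (EFin \o (fun p => u p * 'D_e f p)).
Proof.
move=> ee tf iu; have [M MP] := test_function_derive_bounded tf.
apply: integrableMr_bounded iu _ (_ : forall p, _ <= M).
  apply: continuous_measurable_plane.
  by case: tf => _ c1 c2 _; case: ee => ->; [exact: c1|exact: c2].
by move=> p; have [h1 h2] := MP p; case: ee => ->; [exact: h1|exact: h2].
Qed.

End TestFunctions.

(** * A calculus of C^1 functions from which test functions are assembled *)

Section ContinuouslyDifferentiable.
Context {R : realType}.
Implicit Types (f : R * R -> R).

(** The partial derivatives are existential witnesses, so the closure lemmas can supply formulas for
    them without evaluating 'D_e. *)
Definition C1 f : Prop := exists f1 f2 : R * R -> R,
  [/\ continuous f, continuous f1, continuous f2 &
      forall p, is_derive p e1 f (f1 p) /\ is_derive p e2 f (f2 p)].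

Lemma C1_test_function f (K : set (R * R)) : C1 f ->
  compact K -> K `<=` disk -> (forall p, ~ K p -> f p = 0) -> test_function f.
Proof.
move=> [f1 [f2 [_ c1 c2 df]]] cK KD f0; split.
- by move=> p; have [d1 d2] := df p; split; [case: d1|case: d2].
- suff -> : 'D_e1 f = f1 by [].
  by apply/funext => p; have [[_ ->]] := df p.
- suff -> : 'D_e2 f = f2 by [].
  by apply/funext => p; have [_ [_ ->]] := df p.
- by exists K.
Qed.

Lemma C1_cst (a : R) : C1 (cst a).
Proof.
exists (cst 0), (cst 0); split; [exact: cst_continuous..|].
by move=> p; split; exact: is_derive_cst.
Qed.

Lemma C1D f g : C1 f -> C1 g -> C1 (fun p => f p + g p).
Proof.
move=> [f1 [f2 [cf c1 c2 df]]] [g1 [g2 [cg d1 d2 dg]]].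
exists (fun p => f1 p + g1 p), (fun p => f2 p + g2 p); split.
- by move=> p; apply: continuousD; [exact: cf|exact: cg].
- by move=> p; apply: continuousD; [exact: c1|exact: d1].
- by move=> p; apply: continuousD; [exact: c2|exact: d2].
- move=> p; have [a1 a2] := df p; have [b1 b2] := dg p.
  by split; apply: is_deriveD.
Qed.

Lemma C1M f g : C1 f -> C1 g -> C1 (fun p => f p * g p).
Proof.
move=> [f1 [f2 [cf c1 c2 df]]] [g1 [g2 [cg d1 d2 dg]]].
exists (fun p => f p * g1 p + g p * f1 p), (fun p => f p * g2 p + g p * f2 p).
split.
- by move=> p; apply: continuousM; [exact: cf|exact: cg].
- move=> p; apply: (@continuousD _ _ _ (fun p => f p * g1 p) (fun p => g p * f1 p)).
    by apply: continuousM; [exact: cf|exact: d1].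
  by apply: continuousM; [exact: cg|exact: c1].
- move=> p; apply: (@continuousD _ _ _ (fun p => f p * g2 p) (fun p => g p * f2 p)).
    by apply: continuousM; [exact: cf|exact: d2].
  by apply: continuousM; [exact: cg|exact: c2].
- move=> p; have [a1 a2] := df p; have [b1 b2] := dg p.
  by split; apply: is_deriveM.
Qed.

Lemma C1_comp f (g dg : R -> R) : C1 f -> continuous dg ->
  (forall x : R, is_derive x 1 g (dg x)) -> C1 (g \o f).
Proof.
move=> [f1 [f2 [cf c1 c2 df]]] cdg gdg.
have cg := is_derive_continuous gdg.
exists (fun p => dg (f p) * f1 p), (fun p => dg (f p) * f2 p); split.
- by move=> p; apply: continuous_comp; [exact: cf|exact: cg].
- move=> p; apply: continuousM; last exact: c1.
  by apply: (@continuous_comp _ _ _ f dg); [exact: cf|exact: cdg].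
- move=> p; apply: continuousM; last exact: c2.
  by apply: (@continuous_comp _ _ _ f dg); [exact: cf|exact: cdg].
- by move=> p; have [a1 a2] := df p; split; apply: is_derive_comp.
Qed.

Lemma is_derive_affine (a b : R) : is_derive (0 : R) 1 (fun h => h * a + b) a.
Proof.
have -> : (fun h : R => h * a + b) = (fun h => (a *: id) h + cst b h).
  by apply/funext => h /=; rewrite mulrC.
apply: (is_derive_eq (is_deriveD _ _)).
by rewrite addr0 [LHS]mulr1.
Qed.

Lemma C1_fst : C1 fst.
Proof.
exists (cst 1), (cst 0); split; [|exact: cst_continuous..|].
  by move=> p; exact: cvg_fst.
by move=> p; split; apply/is_derive_lineE; exact: is_derive_affine.
Qed.

Lemma C1_snd : C1 snd.
Proof.
exists (cst 0), (cst 1); split; [|exact: cst_continuous..|].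
  by move=> p; exact: cvg_snd.
by move=> p; split; apply/is_derive_lineE; exact: is_derive_affine.
Qed.

Lemma C1N f : C1 f -> C1 (fun p => - f p).
Proof.
move=> cf; have := C1M (C1_cst (-1)) cf.
by congr C1; apply/funext => p; rewrite mulN1r.
Qed.

(** A quadratic error bounds the error of the difference quotient by |h|. This treats the junction
    of [posq] at 0 together with all other points. *)
Lemma is_derive_quadratic (g : R -> R) (s l : R) :
  (forall h, `|g (h + s) - g s - h * l| <= h ^+ 2) -> is_derive s 1 g l.
Proof.
move=> H.
have cv : (h^-1 *: ((g \o shift s) (h *: 1) - g s)) @[h --> 0^'] --> l.
  apply/cvgrPdist_le => e e0; near=> h.
  have h0 : h != 0 by near: h; exact: nbhs_dnbhs_neq.
  have he : `|h| <= e by near: h; exact: dnbhs0_le.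
  have -> : l - h^-1 *: ((g \o shift s) (h *: 1) - g s) =
      - (h^-1 * (g (h + s) - g s - h * l)).
    by rewrite /= [h *: 1]mulr1 [h^-1 *: _]mulrC; field.
  rewrite normrN normrM normfV ler_pdivrMl ?normr_gt0//.
  rewrite (le_trans (H h))// -(real_normK (num_real h)) expr2.
  by rewrite ler_wpM2l.
apply: DeriveDef; first by apply/cvg_ex; exists l.
exact: cvg_lim cv.
Unshelve. all: by end_near. Qed.

(* A C^1 function that is positive exactly on the open half line. *)
Definition posq (s : R) : R := Num.max 0 s ^+ 2.

Lemma posq_ge0 s : 0 <= posq s. Proof. exact: sqr_ge0. Qed.

Lemma posq_eq0 s : s <= 0 -> posq s = 0.
Proof. by move=> s0; rewrite /posq max_l// expr0n. Qed.

Lemma posqE s : 0 <= s -> posq s = s ^+ 2.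
Proof. by move=> s0; rewrite /posq max_r. Qed.

Lemma posq_gt0 s : 0 < s -> 0 < posq s.
Proof. by move=> s0; rewrite posqE ?ltW// exprn_gt0. Qed.

Lemma is_derive_posq (s : R) : is_derive s 1 posq (2 * Num.max 0 s).
Proof.
apply: is_derive_quadratic => h.
have [s0|/ltW s0] := leP 0 s; have [t0|/ltW t0] := leP 0 (h + s).
- by rewrite (posqE t0) (posqE s0) (_ : _ - _ - _ = h ^+ 2) ?ger0_norm ?sqr_ge0//; ring.
- rewrite (posq_eq0 t0) (posqE s0) ler_norml; apply/andP; split; nra.
- rewrite (posqE t0) (posq_eq0 s0) ler_norml; apply/andP; split; nra.
- by rewrite (posq_eq0 t0) (posq_eq0 s0) !(subr0, mulr0) normr0 sqr_ge0.
Qed.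

Lemma continuous_max0 : continuous (fun s : R => 2 * Num.max 0 s).
Proof.
have c0 : continuous (fun s : R => Num.max 0 s : R).
  move=> s; apply: (@continuous_max _ _ (cst 0) id).
    exact: cst_continuous.
  exact: cvg_id.
by move=> s; apply: cvgM; [exact: cvg_cst|exact: c0].
Qed.

Lemma C1_posq f : C1 f -> C1 (fun p => posq (f p)).
Proof. by move=> cf; exact: C1_comp cf continuous_max0 is_derive_posq. Qed.

Lemma C1_expR f : C1 f -> C1 (fun p => expR (f p)).
Proof.
move=> cf; exact: (C1_comp cf (@continuous_expR R) (@is_derive_expR R)).
Qed.

End ContinuouslyDifferentiable.

(** * The fundamental lemma of the calculus of variations on the disk *)

Section FundamentalLemma.
Context {R : realType}.
Local Notation area := (@lebesgue_measure R \x @lebesgue_measure R)%E.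

Definition quadrant (a b : R) : set (R * R) := `]a, +oo[ `*` `]b, +oo[.

Lemma measurable_quadrant a b : measurable (quadrant a b).
Proof. by apply: measurableX; exact: measurable_itv. Qed.

Definition quadrants : set (set (R * R)) :=
  [set A | exists a b, A = quadrant a b].

Lemma quadrants_setI_closed : setI_closed quadrants.
Proof.
move=> _ _ [a [b ->]] [c [d ->]]; exists (Num.max a c), (Num.max b d).
by apply/seteqP; split => -[x y];
  rewrite /quadrant /= !in_itv/= !andbT !gt_max;
  [move=> [[-> ->] [-> ->]]|move=> [/andP[-> ->] /andP[-> ->]]].
Qed.

(** The product sigma-algebra is the least one making both projections measurable, and an open half
    plane is a union of quadrants whose other corner coordinate runs through -n. *)
Lemma measurable_planeE : @measurable _ (R * R)%type = <<s quadrants >>.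
Proof.
apply/seteqP; split; last first.
  apply: smallest_sub; first exact: sigma_algebra_measurable.
  by move=> _ [a [b ->]]; exact: measurable_quadrant.
pose T := g_sigma_algebraType quadrants.
have mfst : measurable_fun [set: T] (fst : T -> R).
  apply: (measurability _ (RGenOInfty.measurableE R)) => //.
  move=> _ [_ [a ->] <-]; rewrite setTI.
  have -> : fst @^-1` `]a, +oo[ = \bigcup_n quadrant a (- n%:R).
    apply/seteqP; split => [[x y]|[x y] [n _ []]] //=.
    rewrite /= in_itv/= andbT => ax; exists (Num.bound y) => //.
    split; rewrite /= in_itv/= andbT// ltrNl.
    exact: unstable.ltrNbound.
  apply: bigcupT_measurable => n; apply: sub_sigma_algebra.
  by exists a, (- n%:R).
have msnd : measurable_fun [set: T] (snd : T -> R).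
  apply: (measurability _ (RGenOInfty.measurableE R)) => //.
  move=> _ [_ [a ->] <-]; rewrite setTI.
  have -> : snd @^-1` `]a, +oo[ = \bigcup_n quadrant (- n%:R) a.
    apply/seteqP; split => [[x y]|[x y] [n _ []]] //=.
    rewrite /= in_itv/= andbT => ax; exists (Num.bound x) => //.
    split; rewrite /= in_itv/= andbT// ltrNl.
    exact: unstable.ltrNbound.
  apply: bigcupT_measurable => n; apply: sub_sigma_algebra.
  by exists (- n%:R), a.
apply: smallest_sub; first exact: smallest_sigma_algebra.
move=> A [|] [B mB <-].
  exact: mfst.
exact: msnd.
Qed.

(* The last factor depends on N so that the support is compact in the disk
   while the limit is the indicator of the quadrant on the whole disk. *)
Definition cutoff (a b : R) (N : nat) (p : R * R) : R :=
  1 - expR (- (N%:R * (posq (p.1 - a) * posq (p.2 - b) *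
                       posq (1 - N.+1%:R^-1 - (p.1 ^+ 2 + p.2 ^+ 2))))).

Lemma compact_disk_closed (r : R) :
  compact [set p : R * R | p.1 ^+ 2 + p.2 ^+ 2 <= r].
Proof.
(* x^2 <= r forces |x| <= |r| + 1, a bound that avoids square roots and case distinctions on r. *)
apply: (@subclosed_compact _ _ (`[- (`|r| + 1), `|r| + 1] `*` `[- (`|r| + 1), `|r| + 1])).
- have /continuous_closedP/(_ _ (@closed_le R r)) := @continuous_sqr_norm R.
  by congr closed; apply/seteqP; split.
- by apply: compact_setX; exact: segment_compact.
move=> [x y] /= h; have := ler_norm r; have := normr_ge0 r.
by move: `|r| h => s h s0 rs; split; rewrite /= in_itv/=; apply/andP; split; nra.
Qed.

Lemma C1_cutoff a b N : C1 (cutoff a b N).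
Proof.
have Cx c : C1 (fun p : R * R => p.1 - c) by apply: C1D C1_fst (C1_cst _).
have Cy c : C1 (fun p : R * R => p.2 - c) by apply: C1D C1_snd (C1_cst _).
apply: C1D (C1_cst _) (C1N _); apply: C1_expR; apply: C1N.
apply: C1M (C1_cst _) _; apply: C1M (C1M (C1_posq (Cx _)) (C1_posq (Cy _))) _.
apply: C1_posq; apply: C1D (C1_cst _) (C1N _).
by apply: C1D (C1M C1_fst C1_fst) (C1M C1_snd C1_snd).
Qed.

Lemma test_function_cutoff a b N : test_function (cutoff a b N).
Proof.
have := C1_test_function (C1_cutoff a b N) (@compact_disk_closed (1 - N.+1%:R^-1)).
apply.
  move=> p /= h; rewrite /disk/= (le_lt_trans h)// ltrBlDr ltrDl invr_gt0 ltr0n.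
move=> p /= /negP; rewrite -ltNge => h.
rewrite /cutoff (@posq_eq0 _ (_ - (_ + _))); last by rewrite subr_le0 ltW.
by rewrite !mulr0 oppr0 expR0 subrr.
Qed.

Lemma posq_le (s t : R) : s <= t -> posq s <= posq t.
Proof.
move=> st; have m0 (x : R) : 0 <= Num.max 0 x by rewrite le_max lexx.
by rewrite /posq ler_sqr ?nnegrE// ge_max m0 le_max st orbT.
Qed.

Lemma cutoff_norm_le1 a b N p : `|cutoff a b N p| <= 1.
Proof.
rewrite /cutoff; set t := N%:R * _.
have t0 : 0 <= t by rewrite mulr_ge0// mulr_ge0 ?posq_ge0// mulr_ge0 ?posq_ge0.
have := expR_gt0 (- t); have : expR (- t) <= 1 by rewrite expR_le1 oppr_le0.
by move=> h1 h2; rewrite ler_norml; apply/andP; split; lra.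
Qed.

Lemma cvg_cutoff a b p : disk p ->
  cutoff a b N p @[N --> \oo] --> (\1_(quadrant a b) p : R).
Proof.
move=> Dp; rewrite indicE; have [/set_mem[]|] := boolP (p \in quadrant a b).
  rewrite /= !in_itv/= !andbT => ap bp.
  set s := p.1 ^+ 2 + p.2 ^+ 2 : R; have s1 : s < 1 by [].
  (* Once 1 / (N + 1) is below (1 - s) / 2, the last factor of the cutoff is at least
     [posq ((1 - s) / 2)], so the exponent dominates N * c with c independent of N. *)
  pose c := posq (p.1 - a) * posq (p.2 - b) * posq ((1 - s) / 2).
  have c0 : 0 < c.
    by apply: mulr_gt0; [apply: mulr_gt0|]; apply: posq_gt0; lra.
  have h : 0 < (1 - s) / 2 by rewrite divr_gt0 ?subr_gt0.
  apply/cvgrPdist_le => /= e e0; near=> N.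
  rewrite /cutoff -/s opprB addrC subrK ger0_norm ?expR_ge0//.
  set t := N%:R * _.
  have ct : N%:R * c <= t.
    apply: ler_wpM2l => //; apply: ler_wpM2l.
      by apply: mulr_ge0; exact: posq_ge0.
    apply: posq_le.
    have : N.+1%:R^-1 < (1 - s) / 2.
      by near: N; exact: (near_infty_natSinv_lt (PosNum h)).
    by move: (N.+1%:R^-1 : R) => z; lra.
  (* This gives e * t >= 1, and then expR (- t) <= e because expR t >= t. *)
  have Ne : 1 / (e * c) <= N%:R by near: N; exact: nbhs_infty_ger.
  have et : 1 <= e * t.
    apply: (@le_trans _ _ (e * (N%:R * c))); last by rewrite ler_pM2l.
    by rewrite mulrCA -ler_pdivrMr; [exact: Ne|exact: mulr_gt0].
  rewrite expRN -div1r ler_pdivrMr ?expR_gt0// (le_trans et)// ler_pM2l//.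
  by have := expR_ge1Dx t; lra.
move=> /negP ap; rewrite (_ : (fun N => _) = cst 0); first exact: cvg_cst.
apply/funext => N /=; rewrite /cutoff.
have [pa|pa] := leP p.1 a.
  by rewrite (@posq_eq0 _ (p.1 - a)) ?subr_le0// !(mul0r, mulr0) oppr0 expR0 subrr.
have [pb|pb] := leP p.2 b.
  by rewrite (@posq_eq0 _ (p.2 - b)) ?subr_le0// !(mul0r, mulr0) oppr0 expR0 subrr.
by exfalso; apply: ap; apply/mem_set; split; rewrite /= in_itv/= andbT.
Unshelve. all: by end_near. Qed.


(** The cutoffs are test functions bounded by 1, so dominated convergence with bound |g| passes to
    the indicator of the quadrant. *)
Lemma integral_quadrant_eq0 (g : R * R -> R) :
  area.-integrable disk (EFin \o g) ->
  (forall f, test_function f -> \int[area]_(p in disk) (g p * f p) = 0) ->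
  forall a b, (\int[area]_(p in disk `&` quadrant a b) (g p)%:E)%E = 0%E.
Proof.
move=> ig gf a b.
have mq := measurable_quadrant a b; have mD := @measurable_disk R.
have mg : measurable_fun disk g by apply/measurable_EFinP; exact: measurable_int ig.
have ic N : area.-integrable disk (EFin \o (fun p => g p * cutoff a b N p)).
  by apply: integrable_test => //; exact: test_function_cutoff.
(* [Rintegral] applies [fine], which also sends infinite values to 0; integrability is what lifts
   the equation back to extended reals. *)
have c0 N : (\int[area]_(p in disk) (g p * cutoff a b N p)%:E)%E = 0%E.
  have := gf _ (test_function_cutoff a b N); rewrite /Rintegral => h.
  by rewrite -[LHS]fineK ?h//; exact: (integrable_fin_num _ (ic N)).
have mq1 : measurable_fun disk (\1_(quadrant a b) : _ -> R).
  exact: measurable_indic.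
have mf : measurable_fun disk (fun p => (g p * \1_(quadrant a b) p)%:E).
  by apply/measurable_EFinP; exact: measurable_funM.
have cvf : {ae area, forall p, disk p -> (g p * cutoff a b N p)%:E @[N --> \oo] -->
    (g p * \1_(quadrant a b) p)%:E}.
  apply: aeW => p Dp; apply/cvg_EFin; first by apply: nearW.
  by apply: cvgM; [exact: cvg_cst|exact: cvg_cutoff].
have fg : {ae area, forall p (N : nat), disk p ->
    (`|(g p * cutoff a b N p)%:E| <= `|(g p)%:E|)%E}.
  apply: aeW => p N Dp; rewrite /= lee_fin normrM ler_piMr//.
  exact: cutoff_norm_le1.
have [_ _ cv] := @dominated_convergence _ _ _ area disk mD
  (fun N p => (g p * cutoff a b N p)%:E) (fun p => (g p * \1_(quadrant a b) p)%:E)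
  (fun p => `|(g p)%:E|%E) (fun N => measurable_int _ (ic N)) mf cvf
  (integrable_abse ig) fg.
rewrite integral_mkcondr.
transitivity (\int[area]_(p in disk) (g p * \1_(quadrant a b) p)%:E)%E.
  apply: eq_integral => p _; rewrite /patch indicE.
  by case: ifPn => _; rewrite ?mulr1 ?mulr0.
apply: (cvg_unique _ cv); first exact: ereal_hausdorff.
rewrite (_ : (fun N => _) = cst 0%E); first exact: cvg_cst.
by apply/funext => N; exact: c0.
Qed.


(** The sets over which g has zero integral form a Dynkin system containing the quadrants, hence all
    measurable sets. *)
Lemma ae_eq0_test (g : R * R -> R) :
  area.-integrable disk (EFin \o g) ->
  (forall f, test_function f -> \int[area]_(p in disk) (g p * f p) = 0) ->
  ae_eq area disk (EFin \o g) (cst 0%E).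
Proof.
move=> ig gf; have mD := @measurable_disk R.
suff H A : measurable A -> (\int[area]_(p in disk `&` A) (g p)%:E)%E = 0%E.
  apply: integral_ae_eq => // E ED mE; rewrite integral0.
  by rewrite -(H E mE); congr integral; apply/esym/setIidPr.
(* One quadrant already contains the disk, so the total integral vanishes; the complement step of
   the induction relies on it. *)
have Dq : disk `&` quadrant (-1) (-1) = @disk R.
  apply/setIidPl => p /disk_bound[]; rewrite !ltr_norml => /andP[h1 _] /andP[h2 _].
  by split; rewrite /= in_itv/= andbT.
have iD : (\int[area]_(p in disk) (g p)%:E)%E = 0%E.
  by rewrite -[X in integral _ X]Dq integral_quadrant_eq0.
move=> mA; have : <<s quadrants >> A by rewrite -measurable_planeE.
apply: (@dynkin_induction _ _ quadrants
  (fun A => (\int[area]_(p in disk `&` A) (g p)%:E)%E = 0%E)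
  measurable_planeE quadrants_setI_closed).
- by rewrite setIT.
- by move=> _ [a [b ->]]; exact: integral_quadrant_eq0.
- move=> S mS S0.
  have := @integral_setU _ _ _ area (disk `&` S) (disk `&` ~` S) (EFin \o g).
  rewrite -setIUr setUv setIT S0 add0e iD => <- //.
  - exact: measurableI.
  - by apply: measurableI => //; exact: measurableC.
  - exact: measurable_int ig.
  - by apply/disj_setPS => p [[_ ?] [_ ?]].
move=> F mF tF F0; rewrite setI_bigcupr integral_bigcup.
- by apply: eseries0 => k _ _; exact: F0.
- exact: trivIset_setIl.
- by move=> k; apply: measurableI => //; exact: mF.
- apply: integrableS ig => //.
    by apply: bigcupT_measurable => k; apply: measurableI => //; exact: mF.
  by move=> p [k _ []].
Qed.

End FundamentalLemma.

(** * Linearity and uniqueness of weak derivatives *)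

Section WeakDerivatives.
Context {R : realType}.
Local Notation area := (@lebesgue_measure R \x @lebesgue_measure R)%E.
Implicit Types (u v g h : R * R -> R).

Lemma integrable_linear (D : set (R * R)) u v (a b : R) : measurable D ->
  area.-integrable D (EFin \o u) -> area.-integrable D (EFin \o v) ->
  area.-integrable D (EFin \o (fun p => a * u p + b * v p)).
Proof.
move=> mD iu iv.
have -> : EFin \o (fun p => a * u p + b * v p) =
    ((fun p => a%:E * (EFin \o u) p) \+ (fun p => b%:E * (EFin \o v) p))%E.
  by apply/funext => p /=; rewrite EFinD !EFinM.
by apply: integrableD => //; exact: integrableZl.
Qed.

Lemma Rintegral_linear (D : set (R * R)) u v (a b : R) : measurable D ->
  area.-integrable D (EFin \o u) -> area.-integrable D (EFin \o v) ->
  \int[area]_(p in D) (a * u p + b * v p) =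
  a * \int[area]_(p in D) u p + b * \int[area]_(p in D) v p.
Proof.
move=> mD iu iv; rewrite RintegralD ?RintegralZl//.
  have -> : EFin \o (fun p => a * u p) = (fun p => a%:E * (EFin \o u) p)%E.
    by apply/funext => p /=; rewrite EFinM.
  exact: integrableZl.
have -> : EFin \o (fun p => b * v p) = (fun p => b%:E * (EFin \o v) p)%E.
  by apply/funext => p /=; rewrite EFinM.
exact: integrableZl.
Qed.

Lemma L2_disk_linear u v (a b : R) : L2_disk u -> L2_disk v ->
  L2_disk (fun p => a * u p + b * v p).
Proof.
move=> [mu iu] [mv iv].
have m1 : measurable_fun disk (fun p : R * R => a * u p + b * v p).
  by apply: measurable_funD; apply: measurable_funM.
split => //.
have mD := @measurable_disk R.
(* Dominating function from (a u + b v)^2 <= 2 a^2 u^2 + 2 b^2 v^2, that is, (a u - b v)^2 >= 0. *)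
have := @integrable_linear disk _ _ (2 * a ^+ 2) (2 * b ^+ 2) mD iu iv.
apply: le_integrable => //.
  by apply/measurable_EFinP; exact: measurable_funX.
move=> p _; rewrite /= lee_fin ger0_norm ?sqr_ge0//.
rewrite (le_trans _ (ler_norm _))//.
move: (u p) (v p) => x y; have := sqr_ge0 (a * x - b * y); lra.
Qed.

Lemma weak_derivative_linear e u v g h (a b : R) : e = e1 \/ e = e2 ->
  L2_disk u -> L2_disk v -> weak_derivative e u g -> weak_derivative e v h ->
  weak_derivative e (fun p => a * u p + b * v p) (fun p => a * g p + b * h p).
Proof.
move=> ee Lu Lv [Lg ug] [Lh vh]; split; first exact: L2_disk_linear.
move=> f tf; have mD := @measurable_disk R.
have dE (w1 w2 w : R * R -> R) : (fun p => (a * w1 p + b * w2 p) * w p) =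
    (fun p => a * (w1 p * w p) + b * (w2 p * w p)).
  by apply/funext => p; rewrite mulrDl !mulrA.
rewrite !dE !Rintegral_linear//.
- by rewrite ug// vh// !mulrN opprD.
- by apply: integrable_test => //; exact: L2_disk_integrable.
- by apply: integrable_test => //; exact: L2_disk_integrable.
- by apply: integrable_test_derive => //; exact: L2_disk_integrable.
- by apply: integrable_test_derive => //; exact: L2_disk_integrable.
Qed.

Lemma weak_derivative_unique e u g h :
  weak_derivative e u g -> weak_derivative e u h ->
  {ae area, forall p, disk p -> g p = h p}.
Proof.
move=> [Lg ug] [Lh uh]; have mD := @measurable_disk R.
have ig := L2_disk_integrable Lg; have ih := L2_disk_integrable Lh.
have igh := integrable_linear 1 (-1) mD ig ih.
have /= := ae_eq0_test igh; rewrite /ae_eq => H.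
have : ae_eq area disk (EFin \o (fun p => 1 * g p + -1 * h p)) (cst 0%E).
  apply: H => f tf.
  have -> : (fun p => (1 * g p + -1 * h p) * f p) =
      (fun p => 1 * (g p * f p) + -1 * (h p * f p)).
    by apply/funext => p; rewrite mulrDl !mulrA.
  rewrite Rintegral_linear//; [|exact: integrable_test..].
  by rewrite -[X in 1 * X]opprK -ug// uh// opprK mul1r mulN1r subrr.
apply: filterS => p /= + Dp => /(_ Dp) [].
by rewrite mul1r mulN1r => /eqP; rewrite subr_eq0 => /eqP.
Qed.

Lemma weak_partialP e u : (exists g, weak_derivative e u g) ->
  weak_derivative e u (weak_partial e u).
Proof. by move=> /cid[g ug]; rewrite /weak_partial; apply: (xgetI (fun=> 0) ug). Qed.

End WeakDerivatives.

(** * Convexity of the Dirichlet energy, and maps of zero energy *)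

Section Energy.
Context {R : realType} {n : nat}.
Local Notation area := (@lebesgue_measure R \x @lebesgue_measure R)%E.
Implicit Types a b : R * R -> 'rV[R]_n.

Definition energy_density a (p : R * R) : R :=
  \sum_(j < n) (weak_partial e1 (coordinate a j) p ^+ 2 +
                weak_partial e2 (coordinate a j) p ^+ 2).

Lemma energy_density_ge0 a p : 0 <= energy_density a p.
Proof. by apply: sumr_ge0 => j _; rewrite addr_ge0 ?sqr_ge0. Qed.

Lemma energyE a : energy a = \int[area]_(p in disk) energy_density a p.
Proof. by []. Qed.

Lemma energy_ge0 a : 0 <= energy a.
Proof. by apply: Rintegral_ge0 => p _; exact: energy_density_ge0. Qed.

Lemma integrable_energy_density a : (forall j, W12 (coordinate a j)) ->
  area.-integrable disk (EFin \o energy_density a).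
Proof.
move=> Wa; have -> : EFin \o energy_density a =
    (fun p => \sum_(j < n) ((weak_partial e1 (coordinate a j) p ^+ 2 +
       weak_partial e2 (coordinate a j) p ^+ 2)%:E))%E.
  by apply/funext => p; rewrite /= /energy_density -sumEFin.
apply: integrable_sum => [|j _]; first exact: measurable_disk.
have [_ /weak_partialP[[_ i1] _] /weak_partialP[[_ i2] _]] := Wa j.
have -> : (fun p => (weak_partial e1 (coordinate a j) p ^+ 2 +
       weak_partial e2 (coordinate a j) p ^+ 2)%:E) =
  ((fun p => (weak_partial e1 (coordinate a j) p ^+ 2)%:E) \+
   (fun p => (weak_partial e2 (coordinate a j) p ^+ 2)%:E))%E.
  by apply/funext => p; rewrite /= EFinD.
apply: integrableD; [exact: measurable_disk|exact: i1|exact: i2].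
Qed.

Definition interpolate (t : R) a b : R * R -> 'rV[R]_n :=
  fun p => (1 - t) *: a p + t *: b p.

Lemma coordinate_interpolate t a b j : coordinate (interpolate t a b) j =
  (fun p => (1 - t) * coordinate a j p + t * coordinate b j p).
Proof. by apply/funext => p; rewrite /coordinate !mxE. Qed.

Lemma W12_interpolate t a b j : W12 (coordinate a j) -> W12 (coordinate b j) ->
  W12 (coordinate (interpolate t a b) j).
Proof.
move=> [La [g1 a1] [g2 a2]] [Lb [h1 b1] [h2 b2]]; rewrite coordinate_interpolate.
split; first exact: L2_disk_linear.
- by eexists; apply: weak_derivative_linear La Lb a1 b1; left.
- by eexists; apply: weak_derivative_linear La Lb a2 b2; right.
Qed.

(** [weak_partial] is a chosen representative, so it is linear only almost everywhere, by uniqueness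
    of weak derivatives. *)
Lemma weak_partial_interpolate e t a b j : e = e1 \/ e = e2 ->
  W12 (coordinate a j) -> W12 (coordinate b j) ->
  {ae area, forall p, disk p -> weak_partial e (coordinate (interpolate t a b) j) p =
    (1 - t) * weak_partial e (coordinate a j) p +
    t * weak_partial e (coordinate b j) p}.
Proof.
move=> ee Wa Wb.
have Wc := @W12_interpolate t a b j Wa Wb.
have H v : W12 v -> weak_derivative e v (weak_partial e v).
  by move=> [_ d1 d2]; apply: weak_partialP; case: ee => ->; [exact: d1|exact: d2].
have [La _ _] := Wa; have [Lb _ _] := Wb.
have Hc := H _ Wc; rewrite coordinate_interpolate in Hc *.
apply: (weak_derivative_unique Hc).
exact: weak_derivative_linear (H _ Wa) (H _ Wb).
Qed.

Lemma energy_interpolate t a b : 0 <= t <= 1 ->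
  (forall j, W12 (coordinate a j)) -> (forall j, W12 (coordinate b j)) ->
  energy (interpolate t a b) <= (1 - t) * energy a + t * energy b.
Proof.
move=> /andP[t0 t1] Wa Wb; have mD := @measurable_disk R.
have ia := integrable_energy_density Wa; have ib := integrable_energy_density Wb.
have ic := integrable_energy_density (fun j => @W12_interpolate t a b j (Wa j) (Wb j)).
have iab := integrable_linear (1 - t) t mD ia ib.
rewrite !energyE -Rintegral_linear//.
apply: fine_le; [exact: (integrable_fin_num _ ic)|exact: (integrable_fin_num _ iab)|].
apply: ae_ge0_le_integral => //.
- by move=> p _; rewrite lee_fin energy_density_ge0.
- exact: measurable_int ic.
- by move=> p _; rewrite lee_fin addr_ge0// mulr_ge0 ?subr_ge0 ?energy_density_ge0.
- exact: measurable_int iab.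
(* There are finitely many coordinates, so their exceptional null sets can be merged into one. *)
have H e : e = e1 \/ e = e2 -> {ae area, forall p (j : 'I_n), disk p ->
    weak_partial e (coordinate (interpolate t a b) j) p =
    (1 - t) * weak_partial e (coordinate a j) p +
    t * weak_partial e (coordinate b j) p}.
  move=> ee; apply: filter_forall => j; exact: weak_partial_interpolate.
have := H _ (or_introl erefl); apply: (@filterS2 _ _ (ae_filter_ringOfSetsType area)) (H _ (or_intror erefl)).
move=> p H2 H1 Dp;  rewrite lee_fin /energy_density.
rewrite !mulr_sumr -big_split; apply: ler_sum => j _ /=.
rewrite H1// H2//.
move: (weak_partial _ _ _) (weak_partial _ _ _) (weak_partial _ _ _) (weak_partial _ _ _).
move=> x y z w.
have h (r s : R) : ((1 - t) * r + t * s) ^+ 2 <= (1 - t) * r ^+ 2 + t * s ^+ 2.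
  (* This product is exactly the gap in the convexity inequality for the square. *)
  have : 0 <= t * (1 - t) * (r - s) ^+ 2 by rewrite mulr_ge0 ?sqr_ge0// mulr_ge0// subr_ge0.
  lra.
have := h w z; have := h y x; lra.
Qed.

(** A nonnegative density with zero integral vanishes almost everywhere, and with it every chosen
    weak partial on the right of the integration by parts. *)
Lemma energy_eq0_weak_derivative a e j f : e = e1 \/ e = e2 ->
  (forall j, W12 (coordinate a j)) -> energy a = 0 -> test_function f ->
  \int[area]_(p in disk) (coordinate a j p * 'D_e f p) = 0.
Proof.
move=> ee Wa E0 tf; have mD := @measurable_disk R.
have ia := integrable_energy_density Wa.
have [_ d1 d2] := Wa j.
have [[mg Lg] ->//] : weak_derivative e (coordinate a j) (weak_partial e (coordinate a j)).
  by apply: weak_partialP; case: ee => ->; [exact: d1|exact: d2].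
have I0 : (\int[area]_(p in disk) `|(energy_density a p)%:E| = 0)%E.
  transitivity ((energy a)%:E); last by rewrite E0.
  rewrite energyE fineK.
    by apply: eq_integral => p _; rewrite gee0_abs// lee_fin energy_density_ge0.
  exact: (integrable_fin_num _ ia).
have /(_ (measurable_int _ ia))[/(_ I0) ae0 _] :=
  @ae_eq_integral_abs _ _ _ area disk mD (EFin \o energy_density a).
rewrite /Rintegral (@ae_eq_integral _ _ _ _ _ (cst 0%E)) ?integral0 ?oppr0//.
  apply/measurable_EFinP; apply: measurable_funM => //.
  apply: measurable_funTS.
  exact: continuous_measurable_plane (test_function_continuous tf).
have sqrD_eq0 (x y : R) : x ^+ 2 + y ^+ 2 == 0 -> x = 0 /\ y = 0.
  by rewrite paddr_eq0 ?sqr_ge0// !sqrf_eq0 => /andP[/eqP-> /eqP->].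
apply: filterS ae0 => p H Dp /=.
have [/eqP] := H Dp; rewrite /energy_density psumr_eq0; last first.
  by move=> k _; rewrite addr_ge0 ?sqr_ge0.
move=> /allP/(_ j); rewrite mem_index_enum => /(_ isT)/=.
move=> /sqrD_eq0[h1 h2].
have -> : weak_partial e (coordinate a j) p = 0.
  by case: ee => ->; [exact: h1|exact: h2].
by rewrite mul0r.
Qed.

End Energy.

(** * Comparing the values of a function at two points by integration *)

Section TestIntegrals.
Context {R : realType}.
Local Notation area := (@lebesgue_measure R \x @lebesgue_measure R)%E.
Local Notation leb := (@lebesgue_measure R).

Lemma integral_derive_eq0 (F dF : R -> R) :
  (forall x : R, is_derive x 1 F (dF x)) -> continuous dF ->
  F 1 = F (-1) -> (forall x, 1 < `|x| -> dF x = 0) ->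
  (\int[leb]_x (dF x)%:E = 0)%E.
Proof.
move=> FdF cdF F11 dF0.
have cF := is_derive_continuous FdF.
have -> : (\int[leb]_x (dF x)%:E = \int[leb]_(x in `[(-1)%R, 1%R]) (dF x)%:E)%E.
  rewrite [RHS]integral_mkcond; apply: eq_integral => x _; rewrite /patch.
  case: ifPn => // /negP x11; rewrite dF0// ltNge ler_norml.
  by apply/negP => xx; apply: x11; apply/mem_set; rewrite /= in_itv.
rewrite (@continuous_FTC2 _ dF F) ?F11 ?subee//.
- exact: continuous_subspaceT.
- split; first by move=> x _; case: (FdF x).
  + exact/cvg_at_right_filter/cF.
  + exact/cvg_at_left_filter/cF.
- by move=> x _; rewrite derive1E; case: (FdF x).
Qed.

(** Fubini with the inner integral along e, then the fundamental theorem of calculus on each line.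
    It allows a constant to be subtracted from u in the next comparison. *)
Lemma Rintegral_test_derive f e : e = e1 \/ e = e2 -> test_function f ->
  \int[area]_(p in disk) 'D_e f p = 0.
Proof.
move=> ee tf; have [df c1 c2 [K [cK KD] f0]] := tf.
have mD := @measurable_disk R.
have ce : continuous ('D_e f) by case: ee => ->; [exact: c1|exact: c2].
have f0D (p : R * R) : ~ disk p -> f p = 0 by move=> Dp; apply: f0 => /KD.
have D0 (p : R * R) : ~ disk p -> 'D_e f p = 0.
  by move=> Dp; exact: (@derive_eq0_outside _ f K e p cK f0 (fun Kp => Dp (KD _ Kp))).
have i1 : area.-integrable disk (EFin \o 'D_e f).
  have [M MP] := test_function_derive_bounded tf.
  apply: measurable_bounded_integrable => //.
  - exact: area_disk_lty.
  - exact: measurable_funTS (continuous_measurable_plane ce).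
  exists M; split; first exact: num_real.
  move=> N MN p _; apply: le_trans (ltW MN); have [h1 h2] := MP p.
  by case: ee => ->; [exact: h1|exact: h2].
have DE : (EFin \o 'D_e f) \_ disk = EFin \o 'D_e f.
  apply/funext => p; rewrite /patch; case: ifPn => // /negP Dp.
  by rewrite /= D0// => Dp'; apply: Dp; apply/mem_set.
have iT : area.-integrable setT (EFin \o 'D_e f).
  by rewrite -DE; exact: (@integrable_mkcond _ _ _ area disk (EFin \o 'D_e f) mD).1.
have side (x y : R) : 1 <= `|x| \/ 1 <= `|y| -> ~ disk (x, y).
  by move=> xy /disk_bound[]/=; case: xy; rewrite leNgt => /negP.
rewrite /Rintegral integral_mkcond DE.
case: ee => ee; rewrite {}ee in ce D0 i1 DE iT *.
- rewrite -(integral21_prod_meas1 iT) integral0_eq//= => y _.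
  apply: (@integral_derive_eq0 (fun s => f (s, y)) (fun s => 'D_e1 f (s, y))).
  + by move=> x; have [h _] := df (x, y); exact: is_derive_row (derivableP h).
  + move=> x; apply: (@continuous_comp _ _ _ (fun s : R => (s, y)) ('D_e1 f)).
      exact: (cvg_pair cvg_id (cvg_cst _)).
    exact: ce.
  + by rewrite !f0D//; apply: side; left; rewrite ?normrN normr1.
  + by move=> x x1; rewrite D0//; apply: side; left; exact: ltW.
- rewrite -(integral12_prod_meas1 iT) integral0_eq//= => x _.
  apply: (@integral_derive_eq0 (fun s => f (x, s)) (fun s => 'D_e2 f (x, s))).
  + by move=> y; have [_ h] := df (x, y); exact: is_derive_column (derivableP h).
  + move=> y; apply: (@continuous_comp _ _ _ (fun s : R => (x, s)) ('D_e2 f)).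
      exact: (cvg_pair (cvg_cst _) cvg_id).
    exact: ce.
  + by rewrite !f0D//; apply: side; right; rewrite ?normrN normr1.
  + by move=> y y1; rewrite D0//; apply: side; right; exact: ltW.
Qed.

Lemma area_ball_gt0 (p : R * R) (d : R) : 0 < d -> (0 < area (ball p d))%E.
Proof.
move=> d0; have -> : ball p d = ball p.1 d `*` ball p.2 d by [].
rewrite product_measure1E; [|exact: measurable_ball..].
have b0 (x : R) : (0 < leb (ball x d))%E.
  rewrite ball_itv lebesgue_measure_itv/= lte_fin ltrBlDr -addrA ltrDl addr_gt0//.
  by rewrite -EFinB lte_fin subr_gt0 ltrBlDr -addrA ltrDl addr_gt0.
by apply: mule_gt0; exact: b0.
Qed.

(** If u p and u q differ, subtract their mean: u - m has opposite signs near p and near q, as does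
    w1 - w2, so their product has constant sign. Its integral is zero, yet it is nonzero on a ball
    around p. *)
Lemma weak_derivative0_eq (e : R * R) (u : R * R -> R) (p q : R * R) (d0 : R) :
  e = e1 \/ e = e2 -> area.-integrable disk (EFin \o u) ->
  (forall f, test_function f -> \int[area]_(r in disk) (u r * 'D_e f r) = 0) ->
  disk p -> {for p, continuous u} -> {for q, continuous u} -> 0 < d0 ->
  (forall d, 0 < d <= d0 -> exists f w1 w2 : R * R -> R,
    [/\ test_function f, forall r, 'D_e f r = w1 r - w2 r,
        forall r, 0 <= w1 r /\ 0 <= w2 r,
        forall r, ball p d r -> 0 < w1 r &
        forall r, (~ ball p d r -> w1 r = 0) /\ (~ ball q d r -> w2 r = 0)]) ->
  u p = u q.
Proof.
move=> ee iu u0 Dp cp cq d00 H; apply: contrapT => upq.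
have mD := @measurable_disk R.
(* Multiplying by s makes the function positive near p whichever of the two values is larger. *)
pose s := u p - u q; pose m := (u p + u q) / 2.
have s0 : 0 < s ^+ 2 by rewrite exprn_even_gt0//= subr_eq0; apply/eqP.
have vp : 0 < s * (u p - m) by rewrite (_ : _ * _ = s ^+ 2 / 2) ?divr_gt0// /s /m; field.
have vq : s * (u q - m) < 0.
  by rewrite (_ : _ * _ = - (s ^+ 2 / 2)) ?oppr_lt0 ?divr_gt0// /s /m; field.
pose v r := s * (u r - m).
have cv r : {for r, continuous u} -> {for r, continuous v}.
  move=> cr; apply: cvgM; first exact: cvg_cst.
  by apply: cvgB; [exact: cr|exact: cvg_cst].
have /nbhs_ballP[d1 /= d10 dp] : \forall r \near p, 0 < v r.
  by have := cv _ cp; move/cvgr_gt; exact.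
have /nbhs_ballP[d2 /= d20 dq] : \forall r \near q, v r < 0.
  by have := cv _ cq; move/cvgr_lt; exact.
have /nbhs_ballP[d3 /= d30 pD] := open_nbhs_nbhs (conj (@open_disk R) Dp).
(* Small enough for the test function to exist, for both signs to persist, and for the ball around p
   to stay in the disk. *)
pose d := Num.min (Num.min d0 d1) (Num.min d2 d3).
have dd : 0 < d by rewrite !lt_min d00 d10 d20 d30.
have [dd0 dd1 dd2 dd3] : [/\ d <= d0, d <= d1, d <= d2 & d <= d3].
  by split; rewrite !ge_min lexx ?orbT.
have [|f [w1 [w2 [tf fw w0 w1p wq]]]] := H d; first by rewrite dd.
have iD : area.-integrable disk (EFin \o 'D_e f).
  have := @integrable_test_derive _ f (cst 1) e ee tf.
  have i1 : area.-integrable disk (EFin \o cst 1).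
    apply: measurable_bounded_integrable => //; first exact: area_disk_lty.
    by exists 1; split => // N N1 r _ /=; rewrite normr1 ltW.
  move=> /(_ i1); congr (area.-integrable _ _).
  by apply/funext => r /=; rewrite mul1r.
have iuD := integrable_test_derive ee tf iu.
pose h r := s * (u r * 'D_e f r) + (- (s * m)) * 'D_e f r.
have hE r : h r = v r * (w1 r - w2 r) by rewrite /h /v fw; ring.
have ih : area.-integrable disk (EFin \o h) by exact: integrable_linear.
have h0 r : 0 <= h r.
  rewrite hE; have [w1r w2r] := w0 r; have [wp' wq'] := wq r.
  have [pr|/wp' ->] := pselect (ball p d r).
    have vr := dp _ (le_ball dd1 pr).
    have [qr|/wq' ->] := pselect (ball q d r).
      by have := dq _ (le_ball dd2 qr); rewrite ltNge (ltW vr).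
    by rewrite subr0 mulr_ge0// ltW.
  have [qr|/wq' ->] := pselect (ball q d r); last by rewrite subrr mulr0.
  by rewrite sub0r mulrN -mulNr mulr_ge0// oppr_ge0 ltW// (dq _ (le_ball dd2 qr)).
have Ih : \int[area]_(r in disk) h r = 0.
  by rewrite Rintegral_linear// u0// Rintegral_test_derive// !mulr0 addr0.
have I0 : (\int[area]_(r in disk) `|(h r)%:E| = 0)%E.
  transitivity ((\int[area]_(r in disk) h r)%:E); last by rewrite Ih.
  rewrite fineK.
    by apply: eq_integral => r _; rewrite gee0_abs// lee_fin.
  exact: (integrable_fin_num _ ih).
have /(_ (measurable_int _ ih))[/(_ I0) ae0 _] :=
  @ae_eq_integral_abs _ _ _ area disk mD (EFin \o h).
(* [h] vanishes almost everywhere but is positive on this ball: [v] is positive there, which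
   excludes the ball around q and kills w2. *)
have : area.-negligible (ball p d).
  apply: negligibleS ae0 => r pr /= /(_ (pD _ (le_ball dd3 pr))) [].
  have vr := dp _ (le_ball dd1 pr); rewrite hE; have [_ wq'] := wq r.
  rewrite wq'; first by apply/eqP; rewrite subr0 mulf_neq0// gt_eqF// w1p.
  by move=> qr; have := dq _ (le_ball dd2 qr); rewrite ltNge (ltW vr).
move=> /negligibleP/= n0; have := area_ball_gt0 p dd.
by rewrite n0 ?ltxx//; apply: measurableX; exact: measurable_ball.
Qed.

End TestIntegrals.

(** * Continuous functions with zero weak gradient are constant on the disk *)

Section Constancy.
Context {R : realType}.
Local Notation area := (@lebesgue_measure R \x @lebesgue_measure R)%E.

(** A second difference of [posq]: a quadratic spline, constant on each side of [-d, d], so that two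
    translates differ by a compactly supported function. Its derivative [hat] is the tent of height
    2 d. *)
Definition spline_step (d s : R) : R := posq (s + d) - 2 * posq s + posq (s - d).

Definition hat (d s : R) : R :=
  2 * (Num.max 0 (s + d) - 2 * Num.max 0 s + Num.max 0 (s - d)).

Lemma hat_ge0 d s : 0 < d -> 0 <= hat d s.
Proof. by move=> d0; rewrite /hat; case: (leP 0 (s + d)); case: (leP 0 s);
  case: (leP 0 (s - d)); lra. Qed.

Lemma hat_gt0 d s : `|s| < d -> 0 < hat d s.
Proof.
rewrite ltr_norml => /andP[h1 h2]; rewrite /hat.
by case: (leP 0 (s + d)); case: (leP 0 s); case: (leP 0 (s - d)); lra.
Qed.

Lemma hat_eq0 d s : 0 < d -> d <= `|s| -> hat d s = 0.
Proof.
move=> d0; rewrite ler_normr => /orP[h|h]; rewrite /hat;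
  by case: (leP 0 (s + d)); case: (leP 0 s); case: (leP 0 (s - d)); lra.
Qed.

Lemma spline_step_le d s : 0 < d -> s <= - d -> spline_step d s = 0.
Proof. by move=> d0 sd; rewrite /spline_step !posq_eq0; lra. Qed.

Lemma spline_step_ge d s : 0 < d -> d <= s -> spline_step d s = 2 * d ^+ 2.
Proof. by move=> d0 sd; rewrite /spline_step !posqE; lra. Qed.

Lemma is_derive_shift_comp (g : R -> R) (c s l : R) :
  is_derive (s + c) 1 g l -> is_derive s 1 (fun x => g (x + c)) l.
Proof.
move=> h; apply: (is_derive_eq (@is_derive1_comp _ g (fun x => x + c) s l 1 h _)).
  apply: (is_derive_eq (is_deriveD _ _)); exact: addr0.
exact: mulr1.
Qed.

Lemma is_derive_spline_step (d s : R) : is_derive s 1 (spline_step d) (hat d s).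
Proof.
have h c : is_derive s 1 (fun x => posq (x + c)) (2 * Num.max 0 (s + c)).
  by apply: is_derive_shift_comp; exact: is_derive_posq.
have -> : spline_step d = (fun x => posq (x + d) - (2 *: posq) x + posq (x - d)).
  by [].
apply: (is_derive_eq (is_deriveD (is_deriveB (h d) (is_deriveZ 2 (is_derive_posq s)))
  (h (- d)))).
by rewrite /hat /GRing.scale/=; ring.
Qed.

(** Profile across the direction of transport. It is not differentiated along that direction, so
    being C^1 and positive exactly on ]-d, d[ is enough. *)
Definition bump (d s : R) : R := posq (s + d) * posq (d - s).

Lemma bump_ge0 d s : 0 <= bump d s.
Proof. by apply: mulr_ge0; exact: posq_ge0. Qed.

Lemma bump_gt0 d s : `|s| < d -> 0 < bump d s.
Proof.
by rewrite ltr_norml => /andP[h1 h2]; apply: mulr_gt0; apply: posq_gt0; lra.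
Qed.

Lemma bump_eq0 d s : d <= `|s| -> bump d s = 0.
Proof.
rewrite ler_normr /bump => /orP[h|h].
  by rewrite (@posq_eq0 _ (d - s)) ?mulr0// subr_le0.
by rewrite posq_eq0 ?mul0r//; lra.
Qed.

(* Its derivative along e1 is a bump at (x, y) minus the same bump at (0, y), so
   testing against it compares the values of a function at these points. *)
Definition transport (x y d : R) (p : R * R) : R :=
  (spline_step d (p.1 - x) - spline_step d p.1) * bump d (p.2 - y).

Lemma C1_transport x y d : C1 (transport x y d).
Proof.
have Cx c : C1 (fun p : R * R => p.1 + c) by apply: C1D C1_fst (C1_cst _).
have Cy c : C1 (fun p : R * R => p.2 + c) by apply: C1D C1_snd (C1_cst _).
have Cs f : C1 f -> C1 (fun p => spline_step d (f p)).
  move=> cf; apply: C1D (C1D (C1_posq _) (C1N (C1M (C1_cst 2) (C1_posq cf))))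
    (C1_posq _); exact: C1D cf (C1_cst _).
apply: C1M (C1D (Cs _ (Cx _)) (C1N (Cs _ C1_fst))) (C1M (C1_posq _) (C1_posq _)).
  exact: C1D (Cy _) (C1_cst _).
exact: C1D (C1_cst _) (C1N (Cy _)).
Qed.

Lemma derive_transport x y d p :
  'D_e1 (transport x y d) p = (hat d (p.1 - x) - hat d p.1) * bump d (p.2 - y).
Proof.
case: p => s t; have [f1 [f2 [_ _ _ /(_ (s, t))[h _]]]] := C1_transport x y d.
have [_ ->] := h; have [_ <-] := is_derive_row h.
have -> : (fun s => transport x y d (s, t)) = bump d (t - y) *:
    ((fun s => spline_step d (s - x)) - spline_step d).
  by apply/funext => r; rewrite /transport /= mulrC.
have h1 : is_derive s 1 (fun s => spline_step d (s - x)) (hat d (s - x)).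
  by apply: is_derive_shift_comp; exact: is_derive_spline_step.
have [_ ->] := is_deriveZ (bump d (t - y)) (is_deriveB h1 (is_derive_spline_step d s)).
by rewrite /= mulrC.
Qed.

(** Origin of the 6: at the corners of the box K the squared norm is x^2 + y^2 + 2 d (|x| + |y| +
    d), which is less than x^2 + y^2 + 6 d because |x|, |y| and d are below 1. *)
Lemma test_function_transport x y d : 0 < d ->
  d <= (1 - (x ^+ 2 + y ^+ 2)) / 6 -> test_function (transport x y d).
Proof.
move=> d0 dxy.
pose K : set (R * R) := `[- (`|x| + d), `|x| + d] `*` `[- (`|y| + d), `|y| + d].
have cK : compact K by apply: compact_setX; exact: segment_compact.
apply: (C1_test_function (C1_transport x y d) cK).
  move=> [s t] []/=; rewrite !in_itv/= -!ler_norml => sx ty; rewrite /disk/=.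
  rewrite -(real_normK (num_real s)) -(real_normK (num_real t)).
  move: dxy; rewrite -(real_normK (num_real x)) -(real_normK (num_real y)).
  move: (normr_ge0 s) (normr_ge0 t) (normr_ge0 x) (normr_ge0 y) sx ty.
  move: `|s| `|t| `|x| `|y| => s' t' x' y' s0 t0 x0 y0 sx ty dxy.
  have : s' ^+ 2 <= (x' + d) ^+ 2 by rewrite ler_sqr ?nnegrE// addr_ge0// ltW.
  have : t' ^+ 2 <= (y' + d) ^+ 2 by rewrite ler_sqr ?nnegrE// addr_ge0// ltW.
  have x1 : x' < 1 by nra.
  have y1 : y' < 1 by nra.
  have d1 : d < 1 by nra.
  nra.
move=> [s t] nK; rewrite /transport/=.
have [ty|ty] := leP d `|t - y|; first by rewrite bump_eq0// mulr0.
have sx : `|x| + d < `|s|.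
  rewrite ltNge; apply/negP => sx; apply: nK; split; rewrite /= in_itv/= -ler_norml//.
  by rewrite -(subrK y t) (le_trans (ler_normD _ _))// addrC lerD2l ltW.
have := ler_norm x; have := ler_norm (- x); rewrite normrN => x1 x2.
move: sx; rewrite ltr_normr => /orP[sx|sx].
  (* To the right of the box both steps have reached the same plateau, and to the left both are
     still 0. *)
  by rewrite !spline_step_ge ?subrr ?mul0r//; have := normr_ge0 x; lra.
by rewrite !spline_step_le ?subrr ?mul0r//; have := normr_ge0 x; lra.
Qed.

(** Exchanging the coordinates turns transport along e1 into transport along e2. *)
Let swap (p : R * R) : R * R := (p.2, p.1).

Let continuous_swap : continuous swap.
Proof. by move=> p; exact: (cvg_pair cvg_snd cvg_fst). Qed.

Let is_derive_swap (f : R * R -> R) (v p : R * R) (l : R) :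
  is_derive (swap p) (swap v) f l -> is_derive p v (f \o swap) l.
Proof. by move=> /is_derive_lineE h; apply/is_derive_lineE; exact: h. Qed.

Let test_function_swap f : test_function f -> test_function (f \o swap).
Proof.
move=> tf; have [_ c1 c2 [K [cK KD] f0]] := tf.
have cf := test_function_continuous tf.
have df := test_function_is_derive tf.
apply: (@C1_test_function _ _ (swap @` K)).
- exists ('D_e2 f \o swap), ('D_e1 f \o swap); split.
  + by move=> p; apply: continuous_comp; [exact: continuous_swap|exact: cf].
  + by move=> p; apply: continuous_comp; [exact: continuous_swap|exact: c2].
  + by move=> p; apply: continuous_comp; [exact: continuous_swap|exact: c1].
  + by move=> p; have [h1 h2] := df (swap p); split; apply: is_derive_swap.
- by apply: continuous_compact cK; exact: continuous_subspaceT continuous_swap.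
- by move=> _ [[s t] /KD + <-]; rewrite /disk/= addrC.
- by move=> p nK; apply: f0 => Kp; apply: nK; exists (swap p) => //; case: p {Kp}.
Qed.

(** The path runs from (x, y) horizontally to (0, y), then vertically to the origin; neither segment
    leaves the disk. *)
Lemma weak_gradient0_disk_constant (u : R * R -> R) :
  area.-integrable disk (EFin \o u) -> {in disk, continuous u} ->
  (forall e f, e = e1 \/ e = e2 -> test_function f ->
    \int[area]_(p in disk) (u p * 'D_e f p) = 0) ->
  forall p, disk p -> u p = u (0, 0).
Proof.
move=> iu cu u0 [x y] Dxy.
have cuD p : disk p -> {for p, continuous u} by move=> Dp; apply: cu; exact/mem_set.
have Dy : disk (0, y) by move: Dxy; rewrite /disk/=; have := sqr_ge0 x; lra.
have D0 : disk (0 : R, 0 : R) by rewrite /disk/= expr0n/= addr0 ltr01.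
have ballE (p q : R * R) d : ball p d q <-> `|q.1 - p.1| < d /\ `|q.2 - p.2| < d.
  split=> [[]|[h1 h2]].
    by rewrite -!ball_normE /= => h1 h2; rewrite distrC h1 distrC h2.
  by split; rewrite -ball_normE /= distrC.
have d0 : 0 < (1 - (x ^+ 2 + y ^+ 2)) / 6 by move: Dxy; rewrite /disk/=; lra.
transitivity (u (0, y)).
  apply: (@weak_derivative0_eq _ e1 u _ _ _ _ iu _ Dxy (cuD _ Dxy) (cuD _ Dy) d0).
  - by left.
  - by move=> f; apply: u0; left.
  move=> d /andP[dp dd]; exists (transport x y d),
    (fun p => hat d (p.1 - x) * bump d (p.2 - y)),
    (fun p => hat d p.1 * bump d (p.2 - y)); split.
  - exact: test_function_transport.
  - by move=> r; rewrite derive_transport mulrBl.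
  - by move=> r; split; rewrite mulr_ge0 ?bump_ge0 ?hat_ge0.
  - by move=> r /ballE[h1 h2]; rewrite mulr_gt0 ?hat_gt0 ?bump_gt0.
  - move=> r; split=> nr.
      have [h1|h1] := leP d `|r.1 - x|; first by rewrite hat_eq0// mul0r.
      have [h2|h2] := leP d `|r.2 - y|; first by rewrite bump_eq0// mulr0.
      by exfalso; apply/nr/ballE.
    have [h1|h1] := leP d `|r.1|; first by rewrite hat_eq0// mul0r.
    have [h2|h2] := leP d `|r.2 - y|; first by rewrite bump_eq0// mulr0.
    by exfalso; apply/nr/ballE; rewrite subr0.
have d0' : 0 < (1 - (y ^+ 2 + 0 ^+ 2)) / 6 by move: Dy; rewrite /disk/=; lra.
apply: (@weak_derivative0_eq _ e2 u _ _ _ _ iu _ Dy (cuD _ Dy) (cuD _ D0) d0').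
- by right.
- by move=> f; apply: u0; right.
move=> d /andP[dp dd]; have tt := test_function_transport dp dd.
exists (transport y 0 d \o swap),
  (fun p => hat d (p.2 - y) * bump d (p.1 - 0)),
  (fun p => hat d p.2 * bump d (p.1 - 0)); split.
- exact: test_function_swap.
- move=> r; have [h _] := test_function_is_derive tt (swap r).
  have [_ ->] := @is_derive_swap _ e2 r _ h.
  by rewrite derive_transport mulrBl.
- by move=> r; split; rewrite mulr_ge0 ?bump_ge0 ?hat_ge0.
- by move=> r /ballE[h1 h2]; rewrite mulr_gt0 ?hat_gt0 ?bump_gt0.
- move=> r; split=> nr.
    have [h1|h1] := leP d `|r.2 - y|; first by rewrite hat_eq0// mul0r.
    have [h2|h2] := leP d `|r.1 - 0|; first by rewrite bump_eq0// mulr0.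
    by exfalso; apply/nr/ballE.
  have [h1|h1] := leP d `|r.2|; first by rewrite hat_eq0// mul0r.
  have [h2|h2] := leP d `|r.1 - 0|; first by rewrite bump_eq0// mulr0.
  by exfalso; apply/nr/ballE; rewrite !subr0 in h2 *.
Qed.

End Constancy.

(** * Admissible maps have positive energy and form a convex set *)

Section PositiveEnergy.
Context {R : realType} {n : nat}.

(** A boundary point is approached along its radius, and u is continuous up to the boundary. *)
Lemma disk_constant_closed_disk (u : R * R -> R) :
  {within closed_disk, continuous u} -> (forall p, disk p -> u p = u (0, 0)) ->
  forall p, closed_disk p -> u p = u (0, 0).
Proof.
move=> cu uD [x y] Dxy; apply/eqP; rewrite -subr_eq0 -normr_eq0 eq_le normr_ge0 andbT.
apply/ler_addgt0Pr => e e0; rewrite add0r.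
have /subspace_continuousP/(_ (x, y) Dxy)/cvgrPdist_le/(_ e e0) := cu.
rewrite near_withinE => /nbhs_ballP[d /= d0 H].
(* The first bound keeps the radial point within d of (x, y), the second keeps the factor 1 - t
   between 0 and 1. *)
pose t := Num.min (d / 4) 2^-1.
have t0 : 0 < t by rewrite lt_min divr_gt0//= invr_gt0.
have td : t <= d / 4 by rewrite ge_min lexx.
have t1 : t <= 2^-1 by rewrite ge_min lexx orbT.
have [hx hy] : `|x| <= 1 /\ `|y| <= 1.
  by move: Dxy; rewrite /closed_disk/= !ler_norml => h; split; apply/andP; split; nra.
have Dt : disk ((1 - t) * x, (1 - t) * y).
  rewrite /disk/= !exprMn -mulrDr; move: Dxy; rewrite /closed_disk/=.
  have := sqr_ge0 x; have := sqr_ge0 y; move: (x ^+ 2) (y ^+ 2) => a b; nra.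
rewrite -(uD _ Dt); apply: H.
  have dE (z : R) : `|z| <= 1 -> `|z - (1 - t) * z| < d.
    move=> z1; rewrite (_ : _ - _ = t * z); last by ring.
    by rewrite normrM gtr0_norm//; have := normr_ge0 z; nra.
  by split; rewrite -ball_normE/=; exact: dE.
by move: Dt; rewrite /disk/closed_disk/= => /ltW.
Qed.

Lemma energy_eq0_constant (a : R * R -> 'rV[R]_n) :
  (forall j, W12 (coordinate a j)) -> {within closed_disk, continuous a} ->
  energy a = 0 -> forall p, closed_disk p -> a p = a (0, 0).
Proof.
move=> Wa ca E0 p Dp; apply/rowP => j.
have cu : {within closed_disk, continuous (coordinate a j)}.
  move=> q; apply: (@continuous_comp _ _ _ (a : subspace closed_disk -> _)
    (fun v : 'rV[R]_n => v 0 j)); first exact: ca.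
  exact: coord_continuous.
apply: (disk_constant_closed_disk cu) Dp.
apply: weak_gradient0_disk_constant.
- by have [La _ _] := Wa j; exact: L2_disk_integrable.
- rewrite -(continuous_open_subspace (coordinate a j) (@open_disk R)).
  by apply: continuous_subspaceW cu => q /ltW.
- by move=> e f ee tf; exact: energy_eq0_weak_derivative.
Qed.

Lemma energy_admissible_gt0 (Gamma : 'I_3 -> set 'rV[R]_n) (qm qp : 'rV[R]_n)
    (Psi : 'I_3 -> R * R -> 'rV[R]_n) (Phi : 'I_3 -> R * R -> R * R) alpha i :
  uniform_parameterization Gamma qm qp Psi -> gluing_maps Phi ->
  admissible Psi Phi alpha -> 0 < energy (alpha i).
Proof.
move=> hPsi hPhi [Wa ca _ aPsi]; rewrite lt0r energy_ge0 andbT; apply/eqP => E0.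
have [_ Phim Phip _] := hPhi i; have [[_ [g [_ _ _ gK _]]] _ _ _] := hPsi i.
have cst := energy_eq0_constant (Wa i) (ca i) E0.
have um : upper_arc (-1 : R, 0 : R).
  by split; rewrite /circle/= ?lexx// sqrrN expr1n expr0n addr0.
have up : upper_arc (1 : R, 0 : R).
  by split; rewrite /circle/= ?lexx// expr1n expr0n addr0.
have cm (p : R * R) : upper_arc p -> closed_disk p by rewrite /closed_disk => -[/= -> _].
(* The gluing map fixes both points, so the boundary condition evaluates the constant map there; the
   inverse [g] of the parameterization then gives -1 = 1. *)
have : Psi i (-1, 0) = Psi i (1, 0).
  by rewrite -(aPsi i _ um) -(aPsi i _ up) Phim Phip !cst//; exact: cm.
by move=> /(congr1 g); rewrite !gK// => -[]; lra.
Qed.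

Lemma admissible_interpolate (Psi : 'I_3 -> R * R -> 'rV[R]_n)
    (Phi : 'I_3 -> R * R -> R * R) alpha beta t :
  admissible Psi Phi alpha -> admissible Psi Phi beta ->
  admissible Psi Phi (fun i => interpolate t (alpha i) (beta i)).
Proof.
move=> [Wa ca ma ba] [Wb cb mb bb]; split.
- by move=> i j; exact: W12_interpolate.
- by move=> i p; exact: (cvgD (cvgZ (cvg_cst _) (ca i p)) (cvgZ (cvg_cst _) (cb i p))).
- by move=> i j p Ap; rewrite /interpolate (ma i j)// (mb i j).
- by move=> i p Bp; rewrite /interpolate ba// bb// -scalerDl subrK scale1r.
Qed.

Lemma energy_l2E (c : 'I_3 -> R) (alpha : 'I_3 -> R * R -> 'rV[R]_n) :
  (forall i, 0 < c i) ->
  energy_l2 c alpha =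
  (Num.sqrt (\sum_(i < 3) (c i)^-1 * energy (alpha i) ^+ 2))%:E.
Proof.
move=> c0; rewrite /energy_l2 /compatible.
have c1 i : c i != 0 by rewrite gt_eqF.
have -> : [forall i, (c i == 0) ==> (energy (alpha i) == 0)].
  by apply/forallP => i; rewrite (negbTE (c1 i)).
by under eq_bigl do rewrite c1.
Qed.

End PositiveEnergy.

(** * Finite-sum inequalities relating the two kinds of minimality *)

Section Minimizers.
Context {R : realFieldType} {I : finType}.
Implicit Types k c E F : I -> R.

Lemma ler_sum_sqr_tangent (w E F : I -> R) : (forall i, 0 <= w i) ->
  \sum_i w i * E i ^+ 2 + 2 * \sum_i w i * E i * (F i - E i) <=
  \sum_i w i * F i ^+ 2.
Proof.
move=> w0; rewrite mulr_sumr -big_split; apply: ler_sum => i _ /=.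
by have := mulr_ge0 (w0 i) (sqr_ge0 (F i - E i)); lra.
Qed.

Lemma first_variation_ge0 (w E F : I -> R) : (forall i, 0 <= w i) ->
  (forall t, 0 < t <= 1 ->
    \sum_i w i * E i ^+ 2 <= \sum_i w i * ((1 - t) * E i + t * F i) ^+ 2) ->
  0 <= \sum_i w i * E i * (F i - E i).
Proof.
move=> w0 H; rewrite leNgt; apply/negP.
set P := \sum_i _ => P0; set Q := \sum_i w i * (F i - E i) ^+ 2.
have Q0 : 0 <= Q by apply: sumr_ge0 => i _; rewrite mulr_ge0// sqr_ge0.
have H2 t : 0 < t <= 1 -> 0 <= 2 * P + t * Q.
  move=> t01; have := H _ t01; rewrite -subr_ge0.
  suff -> : \sum_i w i * ((1 - t) * E i + t * F i) ^+ 2 - \sum_i w i * E i ^+ 2 =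
     t * (2 * P + t * Q) by case/andP: t01 => t0 _; rewrite pmulr_rge0.
  rewrite /P /Q !mulr_sumr -big_split mulr_sumr -sumrB.
  by apply: eq_bigr => i _ /=; ring.
(* For this t, 2 P + t Q = (1 + t) P < 0. The denominator is positive even when Q = 0, and t stays
   in ]0, 1]. *)
pose t := - P / (- P + Q).
have d0 : 0 < - P + Q by lra.
have t01 : 0 < t <= 1.
  by rewrite /t divr_gt0 ?oppr_gt0//= ler_pdivrMr// mul1r; lra.
have := H2 _ t01; have : t * (- P + Q) = - P by rewrite divfK// gt_eqF.
by case/andP: t01; nra.
Qed.

Lemma sum_energy_weights (k E : I -> R) : \sum_j E j / k j != 0 ->
  \sum_i E i / (k i * \sum_j (E j / k j)) = 1.
Proof.
set S := \sum_j _ => S0; rewrite -[RHS](divff S0) {2}/S mulr_suml.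
by apply: eq_bigr => i _; rewrite invfM mulrA.
Qed.

Lemma l2_le_of_l1_le (k E F : I -> R) (s : R) :
  (forall i, 0 < k i) -> (forall i, 0 < E i) -> 0 < s ->
  \sum_i k i * E i <= \sum_i k i * F i ->
  \sum_i (E i / (k i * s))^-1 * E i ^+ 2 <= \sum_i (E i / (k i * s))^-1 * F i ^+ 2.
Proof.
move=> k0 E0 s0 EF; have w0 i : 0 <= (E i / (k i * s))^-1.
  by rewrite invr_ge0 divr_ge0 ?mulr_ge0// ltW.
apply: le_trans (ler_sum_sqr_tangent E F w0); rewrite lerDl mulr_ge0//.
have -> : \sum_i (E i / (k i * s))^-1 * E i * (F i - E i) =
    s * (\sum_i k i * F i - \sum_i k i * E i).
  rewrite -sumrB mulr_sumr; apply: eq_bigr => i _.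
  by field; rewrite !gt_eqF.
by rewrite mulr_ge0 ?subr_ge0// ltW.
Qed.

(** The hypothesis involves interpolated energies, not energies of interpolated maps; convexity
    bridges the two where the lemma is applied. *)
Lemma l1_le_of_l2_min (c x E F : I -> R) (s : R) :
  (forall i, 0 < c i) -> 0 < s -> (forall i, x i = c i * s) ->
  (forall t, 0 < t <= 1 ->
    \sum_i (c i)^-1 * E i ^+ 2 <=
    \sum_i (c i)^-1 * ((1 - t) * E i + t * F i) ^+ 2) ->
  \sum_i E i / x i * E i <= \sum_i E i / x i * F i.
Proof.
move=> c0 s0 xE H.
have w0 i : 0 <= (c i)^-1 by rewrite invr_ge0 ltW.
have P0 := first_variation_ge0 w0 H; rewrite -subr_ge0 -sumrB.
have -> : \sum_i (E i / x i * F i - E i / x i * E i) =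
    s^-1 * \sum_i (c i)^-1 * E i * (F i - E i).
  rewrite mulr_sumr; apply: eq_bigr => i _; rewrite xE.
  by field; rewrite !gt_eqF.
by rewrite mulr_ge0 ?invr_ge0// ltW.
Qed.

End Minimizers.

Theorem lemma3 (R : realType) (n : nat)
    (Gamma : 'I_3 -> set 'rV[R]_n) (qm qp : 'rV[R]_n)
    (Psi : 'I_3 -> R * R -> 'rV[R]_n) (Phi : 'I_3 -> R * R -> R * R)
    (hGamma : embedded_graph Gamma qm qp)
    (hPsi : uniform_parameterization Gamma qm qp Psi)
    (hPhi : gluing_maps Phi) :
  (forall (k : 'I_3 -> R) (alpha : 'I_3 -> R * R -> 'rV[R]_n),
     (forall i, 0 < k i) ->
     l1_minimizing Psi Phi k alpha ->
     let c := fun i : 'I_3 =>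
       energy (alpha i) / (k i * \sum_(j < 3) (energy (alpha j) / k j)) in
     simplex c /\ l2_minimizing Psi Phi c alpha)
  /\
  (forall (c : 'I_3 -> R) (alpha : 'I_3 -> R * R -> 'rV[R]_n),
     simplex c ->
     l2_minimizing Psi Phi c alpha ->
     forall x : 'cV[R]_3,
       ((\matrix_(i < 3, j < 3) c i) - 1%:M) *m x = 0 ->
       (forall i, 0 < x i 0) ->
       let k := fun i : 'I_3 => energy (alpha i) / x i 0 in
       (forall i, 0 < k i) /\ l1_minimizing Psi Phi k alpha).
Proof.
have Epos alpha : admissible Psi Phi alpha -> forall i, 0 < energy (alpha i).
  by move=> aa i; exact: (energy_admissible_gt0 i hPsi hPhi aa).
split.
- move=> k alpha k0 [aa amin] c.
  have E0 := Epos _ aa.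
  have S0 : 0 < \sum_(j < 3) (energy (alpha j) / k j).
    rewrite (bigD1 ord0)//= ltr_wpDr ?divr_gt0//.
    by apply: sumr_ge0 => j _; rewrite ltW// divr_gt0.
  have c0 i : 0 < c i by rewrite divr_gt0// mulr_gt0.
  split.
    split; last by move=> i; exact: ltW.
    by apply: (@sum_energy_weights R 'I_3 k (energy \o alpha)); rewrite gt_eqF.
  split; first exact: aa.
  move=> beta ab; rewrite !(energy_l2E _ c0) lee_fin; apply: ler_wsqrtr.
  exact: (@l2_le_of_l1_le R 'I_3 k (energy \o alpha) (energy \o beta) _ k0 E0 S0
    (amin _ ab)).
move=> c alpha [c1 c0] [aa amin] x Cx x0 k.
have E0 := Epos _ aa.
(* Row i of C x = x, all entries of row i of C being c_i. *)
have xE i : x i 0 = c i * \sum_j x j 0.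
  have /matrixP/(_ i 0) := Cx; rewrite mulmxBl mul1mx !mxE => /eqP.
  rewrite subr_eq0 => /eqP <-; rewrite mulr_sumr.
  by apply: eq_bigr => j _; rewrite mxE.
have X0 : 0 < \sum_j x j 0.
  rewrite (bigD1 ord0)//= ltr_wpDr//.
  by apply: sumr_ge0 => j _; exact: ltW.
(* If some c_i were 0, no admissible map would be compatible with c and all would have infinite l^2
   energy; positivity of x excludes this case. *)
have cpos i : 0 < c i by have := x0 i; rewrite xE pmulr_lgt0.
split; first by move=> i; rewrite divr_gt0.
split; first exact: aa.
move=> beta ab.
apply: (@l1_le_of_l2_min R 'I_3 c (fun i => x i 0) (energy \o alpha)
  (energy \o beta) _ cpos X0 xE) => t /andP[t0 t1].
have := amin _ (admissible_interpolate t aa ab).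
rewrite !(energy_l2E _ cpos) lee_fin ler_sqrt; last first.
  by apply: sumr_ge0 => i _; rewrite mulr_ge0 ?invr_ge0 ?sqr_ge0// ltW.
(* Minimality compares alpha with the interpolated map; convexity now bounds each of its energies,
   and squaring preserves the bound between nonnegative numbers. *)
move=> /le_trans; apply; apply: ler_sum => i _ /=.
rewrite ler_wpM2l ?invr_ge0 ?(ltW (cpos i))//.
have t01 : 0 <= t <= 1 by rewrite ltW.
have [Wa _ _ _] := aa; have [Wb _ _ _] := ab.
have := energy_interpolate t01 (Wa i) (Wb i).
rewrite ler_sqr ?nnegrE ?energy_ge0// addr_ge0// mulr_ge0 ?energy_ge0 ?subr_ge0//.
exact: ltW.
Qed.
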